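(* (In $\mathbf{ZF}$.) For every second-countable, Cantor completely metrizable space $\mathbf{X}$ with underlying set $X$, the following statements are all equivalent: (1) every infinite subset of $X$ is Dedekind-infinite; (2) every infinite subset of $X$ contains an infinite $G_\delta$-set of $\mathbf{X}$; (3) every infinite subset of $X$ contains an infinite $F_\sigma$-set of $\mathbf{X}$; (4) every infinite sequentially closed subset of $\mathbf{X}$ contains an infinite closed subset of $\mathbf{X}$.
   Context: The result is a theorem of $\mathbf{ZF}$ (Zermelo–Fraenkel set theory without the axiom of choice). A set is infinite if it is not equipotent with any $n\in\omega$; it is Dedekind-infinite if it is equipotent with a proper subset of itself. A set $A\subseteq X$ is sequentially closed in $\mathbf{X}$ if every point of $X$ which is a limit of a sequence of points of $A$ converging in $\mathbf{X}$ belongs to $A$. For a metric $d$ on $X$, $\tau(d)$ is the topology induced by $d$ and $\delta_d(A)=\sup\{d(x,y):x,y\in A\}$. A metric $d$ on $X$ is Cantor complete if, for every descending family $\{F_n:n\in\omega\}$ of non-empty closed subsets of $\langle X,\tau(d)\rangle$ with $\lim_{n\to+\infty}\delta_d(F_n)=0$, we have $\bigcap_{n\in\omega}F_n\neq\emptyset$. A topological space $\langle X,\tau\rangle$ is Cantor completely metrizable if there is a Cantor complete metric $d$ on $X$ with $\tau=\tau(d)$. *)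

(* Defs.v *)
(** The theorem is one of ZF, so it is stated for every model of first-order ZF
    (by completeness, ZF proves a sentence iff all its models satisfy it).
    Separation and Replacement are schemas over first-order formulas with
    parameters, not over arbitrary predicates [V -> Prop]; otherwise choice
    principles of the metatheory would give the axiom of choice in the models.
    All notions below are first-order over the membership relation, written
    relationally: [is_pair p x y] reads "p = (x,y)", and so on. *)

(** De Bruijn indices: [All] and [Ex] bind index 0. *)
Inductive formula : Type :=
| FMem (i j : nat)
| FEq (i j : nat)
| FBot
| FImp (f g : formula)
| FAnd (f g : formula)
| FOr (f g : formula)
| FAll (f : formula)
| FEx (f : formula).

Definition push {V : Type} (x : V) (e : nat -> V) (n : nat) : V :=
  match n with O => x | S m => e m end.

Fixpoint sat {V : Type} (mem : V -> V -> Prop) (e : nat -> V) (f : formula)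
  : Prop :=
  match f with
  | FMem i j => mem (e i) (e j)
  | FEq i j => e i = e j
  | FBot => False
  | FImp f g => sat mem e f -> sat mem e g
  | FAnd f g => sat mem e f /\ sat mem e g
  | FOr f g => sat mem e f \/ sat mem e g
  | FAll f => forall x, sat mem (push x e) f
  | FEx f => exists x, sat mem (push x e) f
  end.

Record ZF : Type := {
  sets :> Type;
  mem : sets -> sets -> Prop;
  zf_extensionality : forall a b, (forall x, mem x a <-> mem x b) -> a = b;
  zf_foundation : forall a, (exists x, mem x a) ->
    exists x, mem x a /\ forall y, mem y x -> ~ mem y a;
  zf_pairing : forall a b, exists c, forall x, mem x c <-> x = a \/ x = b;
  zf_union : forall a, exists c, forall x,
    mem x c <-> exists b, mem b a /\ mem x b;
  zf_power : forall a, exists c, forall b,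
    mem b c <-> forall x, mem x b -> mem x a;
  zf_infinity : exists a,
    (exists z, mem z a /\ forall x, ~ mem x z) /\
    (forall x, mem x a ->
       exists y, mem y a /\ forall z, mem z y <-> mem z x \/ z = x);
  zf_separation : forall (f : formula) (e : nat -> sets) a,
    exists c, forall x, mem x c <-> mem x a /\ sat mem (push x e) f;
  zf_replacement : forall (f : formula) (e : nat -> sets) a,
    (forall x y y', mem x a ->
       sat mem (push x (push y e)) f -> sat mem (push x (push y' e)) f ->
       y = y') ->
    exists c, forall y,
      mem y c <-> exists x, mem x a /\ sat mem (push x (push y e)) f
}.

Arguments mem {z}.
Notation "x ∈ a" := (mem x a) (at level 70, no associativity).

Definition subset {M : ZF} (a b : M) : Prop := forall x, x ∈ a -> x ∈ b.
Notation "a ⊆ b" := (subset a b) (at level 70, no associativity).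

(** * Natural numbers, pairs and functions *)

Definition is_empty {M : ZF} (a : M) : Prop := forall x, ~ x ∈ a.

Definition nonempty {M : ZF} (a : M) : Prop := exists x, x ∈ a.

Definition is_succ {M : ZF} (n m : M) : Prop :=
  forall x, x ∈ m <-> x ∈ n \/ x = n.

Definition inductive {M : ZF} (a : M) : Prop :=
  (exists z, is_empty z /\ z ∈ a) /\
  (forall n m, n ∈ a -> is_succ n m -> m ∈ a).

(** Von Neumann naturals: [n ⊆ m] is the usual order [n <= m] on them. *)
Definition is_nat {M : ZF} (n : M) : Prop := forall a, inductive a -> n ∈ a.

Definition is_omega {M : ZF} (w : M) : Prop := forall n, n ∈ w <-> is_nat n.

Definition is_upair {M : ZF} (c x y : M) : Prop :=
  forall z, z ∈ c <-> z = x \/ z = y.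

Definition is_pair {M : ZF} (p x y : M) : Prop :=
  exists s u, is_upair s x x /\ is_upair u x y /\ is_upair p s u.

Definition is_prod {M : ZF} (c a b : M) : Prop :=
  forall p, p ∈ c <-> exists x y, x ∈ a /\ y ∈ b /\ is_pair p x y.

(** (x,y) ∈ r; for a function this reads "r(x) = y". *)
Definition app {M : ZF} (r x y : M) : Prop := exists p, is_pair p x y /\ p ∈ r.

(** "f(x,y) = z". *)
Definition app2 {M : ZF} (f x y z : M) : Prop :=
  exists p, is_pair p x y /\ app f p z.

Definition is_fun {M : ZF} (f a b : M) : Prop :=
  (forall p, p ∈ f -> exists x y, x ∈ a /\ y ∈ b /\ is_pair p x y) /\
  (forall x, x ∈ a -> exists! y, app f x y).

Definition is_fun2 {M : ZF} (f a b c : M) : Prop :=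
  exists p, is_prod p a b /\ is_fun f p c.

Definition equipotent {M : ZF} (a b : M) : Prop :=
  exists f, is_fun f a b /\ forall y, y ∈ b -> exists! x, app f x y.

Definition is_seq {M : ZF} (s a : M) : Prop :=
  exists w, is_omega w /\ is_fun s w a.

Definition infinite {M : ZF} (a : M) : Prop :=
  forall n, is_nat n -> ~ equipotent a n.

Definition dedekind_infinite {M : ZF} (a : M) : Prop :=
  exists b, b ⊆ a /\ b <> a /\ equipotent a b.

Definition countable {M : ZF} (a : M) : Prop :=
  exists b, (forall n, n ∈ b -> is_nat n) /\ equipotent a b.

(** * Real numbers *)

Definition le_of {M : ZF} (lt x y : M) : Prop := app lt x y \/ x = y.

Definition upper_bound {M : ZF} (R lt A u : M) : Prop :=
  u ∈ R /\ forall x, x ∈ A -> le_of lt x u.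

Definition is_lub {M : ZF} (R lt A u : M) : Prop :=
  upper_bound R lt A u /\ forall v, upper_bound R lt A v -> le_of lt u v.

(** The reals of a model: a complete ordered field inside it (ZF proves that
    there is one, unique up to isomorphism). *)
Record reals (M : ZF) : Type := {
  rset : M;
  radd : M;
  rmul : M;
  rlt : M;
  rzero : M;
  rone : M;
  radd_fun : is_fun2 radd rset rset rset;
  rmul_fun : is_fun2 rmul rset rset rset;
  rzero_in : rzero ∈ rset;
  rone_in : rone ∈ rset;
  rone_neq_rzero : rone <> rzero;
  raddA : forall x y z xy yz s, x ∈ rset -> y ∈ rset -> z ∈ rset ->
    app2 radd x y xy -> app2 radd y z yz -> app2 radd x yz s ->
    app2 radd xy z s;
  raddC : forall x y s, x ∈ rset -> y ∈ rset ->
    app2 radd x y s -> app2 radd y x s;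
  radd0 : forall x, x ∈ rset -> app2 radd x rzero x;
  raddN : forall x, x ∈ rset -> exists y, y ∈ rset /\ app2 radd x y rzero;
  rmulA : forall x y z xy yz p, x ∈ rset -> y ∈ rset -> z ∈ rset ->
    app2 rmul x y xy -> app2 rmul y z yz -> app2 rmul x yz p ->
    app2 rmul xy z p;
  rmulC : forall x y p, x ∈ rset -> y ∈ rset ->
    app2 rmul x y p -> app2 rmul y x p;
  rmul1 : forall x, x ∈ rset -> app2 rmul x rone x;
  rmulV : forall x, x ∈ rset -> x <> rzero ->
    exists y, y ∈ rset /\ app2 rmul x y rone;
  rmulD : forall x y z yz xy xz p, x ∈ rset -> y ∈ rset -> z ∈ rset ->
    app2 radd y z yz -> app2 rmul x y xy -> app2 rmul x z xz ->
    app2 rmul x yz p -> app2 radd xy xz p;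
  rlt_irrefl : forall x, x ∈ rset -> ~ app rlt x x;
  rlt_trans : forall x y z, x ∈ rset -> y ∈ rset -> z ∈ rset ->
    app rlt x y -> app rlt y z -> app rlt x z;
  rlt_total : forall x y, x ∈ rset -> y ∈ rset ->
    app rlt x y \/ x = y \/ app rlt y x;
  rlt_add : forall x y z xz yz, x ∈ rset -> y ∈ rset -> z ∈ rset ->
    app rlt x y -> app2 radd x z xz -> app2 radd y z yz -> app rlt xz yz;
  rlt_mul : forall x y p, x ∈ rset -> y ∈ rset ->
    app rlt rzero x -> app rlt rzero y -> app2 rmul x y p -> app rlt rzero p;
  r_complete : forall A, A ⊆ rset -> nonempty A ->
    (exists u, upper_bound rset rlt A u) -> exists u, is_lub rset rlt A u
}.

Arguments rset {M}.
Arguments radd {M}.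
Arguments rmul {M}.
Arguments rlt {M}.
Arguments rzero {M}.
Arguments rone {M}.

Definition lt_R {M : ZF} (R : reals M) (x y : M) : Prop := app (rlt R) x y.

Definition le_R {M : ZF} (R : reals M) (x y : M) : Prop := le_of (rlt R) x y.

Definition positive {M : ZF} (R : reals M) (x : M) : Prop :=
  x ∈ rset R /\ lt_R R (rzero R) x.

(** * Topological spaces <X,T> *)

Definition is_topology {M : ZF} (X T : M) : Prop :=
  (forall U, U ∈ T -> U ⊆ X) /\
  (forall U, is_empty U -> U ∈ T) /\
  X ∈ T /\
  (forall C U, C ⊆ T -> (forall x, x ∈ U <-> exists V, V ∈ C /\ x ∈ V) ->
     U ∈ T) /\
  (forall U V W, U ∈ T -> V ∈ T -> (forall x, x ∈ W <-> x ∈ U /\ x ∈ V) ->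
     W ∈ T).

Definition closed {M : ZF} (X T A : M) : Prop :=
  A ⊆ X /\ exists U, U ∈ T /\ forall x, x ∈ U <-> x ∈ X /\ ~ x ∈ A.

Definition is_base {M : ZF} (T B : M) : Prop :=
  B ⊆ T /\
  forall U x, U ∈ T -> x ∈ U -> exists V, V ∈ B /\ x ∈ V /\ V ⊆ U.

Definition second_countable {M : ZF} (T : M) : Prop :=
  exists B, is_base T B /\ countable B.

Definition is_Gdelta {M : ZF} (X T A : M) : Prop :=
  exists G, is_seq G T /\
    forall x, x ∈ A <->
      x ∈ X /\ forall n U, is_nat n -> app G n U -> x ∈ U.

Definition is_Fsigma {M : ZF} (X T A : M) : Prop :=
  exists K F, (forall C, C ∈ K -> closed X T C) /\ is_seq F K /\
    forall x, x ∈ A <-> exists n C, is_nat n /\ app F n C /\ x ∈ C.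

Definition converges {M : ZF} (T s x : M) : Prop :=
  forall U, U ∈ T -> x ∈ U ->
    exists n, is_nat n /\
      forall m y, is_nat m -> n ⊆ m -> app s m y -> y ∈ U.

Definition sequentially_closed {M : ZF} (X T A : M) : Prop :=
  A ⊆ X /\
  forall s x, is_seq s A -> x ∈ X -> converges T s x -> x ∈ A.

(** * Metrics *)

Definition is_metric {M : ZF} (R : reals M) (X d : M) : Prop :=
  is_fun2 d X X (rset R) /\
  (forall x y r, x ∈ X -> y ∈ X -> app2 d x y r -> le_R R (rzero R) r) /\
  (forall x y, x ∈ X -> y ∈ X -> (app2 d x y (rzero R) <-> x = y)) /\
  (forall x y r, x ∈ X -> y ∈ X -> app2 d x y r -> app2 d y x r) /\
  (forall x y z dxy dyz dxz s, x ∈ X -> y ∈ X -> z ∈ X ->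
     app2 d x y dxy -> app2 d y z dyz -> app2 d x z dxz ->
     app2 (radd R) dxy dyz s -> le_R R dxz s).

Definition is_metric_topology {M : ZF} (R : reals M) (X d T : M) : Prop :=
  forall U, U ∈ T <->
    U ⊆ X /\
    forall x, x ∈ U -> exists eps, positive R eps /\
      forall y r, y ∈ X -> app2 d x y r -> lt_R R r eps -> y ∈ U.

(** Holds for no [r] when the distances in [A] are unbounded (infinite
    diameter). *)
Definition is_diameter {M : ZF} (R : reals M) (d A r : M) : Prop :=
  exists D,
    (forall t, t ∈ D <-> exists x y, x ∈ A /\ y ∈ A /\ app2 d x y t) /\
    is_lub (rset R) (rlt R) D r.

Definition descending {M : ZF} (F : M) : Prop :=
  forall n m A B, is_nat n -> is_succ n m -> app F n A -> app F m B -> B ⊆ A.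

(** Diameters are nonnegative, and finitely many of them may be infinite. *)
Definition diameters_tend_to_zero {M : ZF} (R : reals M) (d F : M) : Prop :=
  forall eps, positive R eps ->
    exists n, is_nat n /\
      forall m A, is_nat m -> n ⊆ m -> app F m A ->
        exists r, is_diameter R d A r /\ lt_R R r eps.

Definition cantor_complete {M : ZF} (R : reals M) (X d : M) : Prop :=
  forall T, is_metric_topology R X d T ->
  forall K F,
    (forall A, A ∈ K -> closed X T A /\ nonempty A) ->
    is_seq F K ->
    descending F ->
    diameters_tend_to_zero R d F ->
    exists x, x ∈ X /\ forall n A, is_nat n -> app F n A -> x ∈ A.

Definition cantor_completely_metrizable {M : ZF} (R : reals M) (X T : M)
  : Prop :=
  exists d, is_metric R X d /\ cantor_complete R X d /\
    is_metric_topology R X d T.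

(* Main.v *)
From Stdlib Require Import Classical ClassicalEpsilon.
Require Import Defs.

(** Fix a countable base, each base set having a natural number as index, and a Cantor
    complete metric. The implications rest on two choice-free constructions.

    From Dedekind-infinity to topology: a Dedekind-infinite set [A] contains the range of an
    injective sequence ([dedekind_sequence]), which is a countable union of closed points and
    so an F-sigma set. If this range has an accumulation point [x], then terms of least
    admissible index form a sequence in [A] without the value [x] that converges to [x]; its
    range is infinite and becomes closed when [x] is added. Otherwise the range is closed
    ([dedekind_subset]). Closed sets are G-delta in a second-countable metric space, and so is
    a closed set without one point. If [A] is sequentially closed, [x] belongs to [A].

    From topology to Dedekind-infinity: let V be a base set that meets a G-delta set, the
    intersection of open sets U_n. Starting from V, pass repeatedly to the base set of least
    index that meets the G-delta set, has diameter at most the n-th term of a fixed null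
    sequence, and has its closure inside the previous set and inside U_n. Completeness yields
    exactly one point common to all these sets, so a point of the G-delta set in V has been
    chosen canonically ([pick_spec]). Doing this for all base sets gives a countable subset
    that must be infinite if the given set is, because finite sets are closed and the subset
    is dense. The argument is uniform enough to treat countably many G-delta sets
    simultaneously ([dedekind_of_union_of_Gdelta]), and this covers F-sigma sets, since closed
    sets are G-delta uniformly ([separator]). A countable infinite set is well-orderable, and
    an infinite well-orderable set is Dedekind-infinite by the successor map on the elements
    with finitely many predecessors ([dedekind_of_well_order]). Finally, a set that is not
    sequentially closed contains a sequence with an outside limit, whose range is infinite.

    Sets of the model are formed by separation, which applies to first-order formulas with
    parameters only. The predicate [definable] expresses this on the level of propositions,
    and the tactic [dfn] establishes it from the shape of a predicate. Definite descriptions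
    ([the]) preserve definability, so the relational vocabulary can be replaced by operations
    such as [pair], [ap] and [pick]. Induction, least elements and the finite-set principle
    carry definability hypotheses for the same reason. *)

(** * Predicates and operations defined by first-order formulas *)

Section Definability.
Context {M : ZF}.
Implicit Types (e p : nat -> M) (P Q : (nat -> M) -> Prop) (t u : (nat -> M) -> M).

Lemma sets_inhabited : inhabited M.
Proof. destruct (zf_infinity M) as [a _]; exact (inhabits a). Qed.

Definition any_set : M := epsilon sets_inhabited (fun _ => True).

Fixpoint rename (r : nat -> nat) (f : formula) : formula :=
  let up n := match n with O => O | S m => S (r m) end in
  match f with
  | FMem i j => FMem (r i) (r j)
  | FEq i j => FEq (r i) (r j)
  | FBot => FBot
  | FImp f g => FImp (rename r f) (rename r g)
  | FAnd f g => FAnd (rename r f) (rename r g)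
  | FOr f g => FOr (rename r f) (rename r g)
  | FAll f => FAll (rename up f)
  | FEx f => FEx (rename up f)
  end.

Lemma sat_rename (f : formula) : forall r e e', (forall n, e (r n) = e' n) ->
  sat (@mem M) e (rename r f) <-> sat (@mem M) e' f.
Proof.
  induction f; intros r e e' H; simpl.
  - rewrite !H; tauto.
  - rewrite !H; tauto.
  - tauto.
  - rewrite (IHf1 r e e' H), (IHf2 r e e' H); tauto.
  - rewrite (IHf1 r e e' H), (IHf2 r e e' H); tauto.
  - rewrite (IHf1 r e e' H), (IHf2 r e e' H); tauto.
  - split; intros K x; specialize (K x); revert K; apply IHf; intros [|n]; simpl; auto.
  - split; intros [x K]; exists x; revert K; apply IHf; intros [|n]; simpl; auto.
Qed.

(** Definability allows parameters from the model. An environment [e] of variables and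
    one [p] of parameters share the indices of a formula: variables sit at the even
    indices and parameters at the odd ones, so that neither is bounded in number. *)
Fixpoint join e p (n : nat) : M :=
  match n with
  | O => e O
  | S O => p O
  | S (S m) => join (fun k => e (S k)) (fun k => p (S k)) m
  end.

Fixpoint even_slot n := match n with O => O | S m => S (S (even_slot m)) end.
Definition odd_slot n := S (even_slot n).

(** The renaming that sends even indices through [a] and odd indices through [b]. *)
Fixpoint copair (a b : nat -> nat) (n : nat) : nat :=
  match n with
  | O => a O
  | S O => b O
  | S (S m) => copair (fun k => a (S k)) (fun k => b (S k)) m
  end.

Lemma join_even_slot n : forall e p, join e p (even_slot n) = e n.
Proof. induction n; intros; simpl; auto. Qed.

Lemma join_odd_slot n : forall e p, join e p (odd_slot n) = p n.
Proof. unfold odd_slot; induction n; intros; [reflexivity|].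
  exact (IHn (fun k => e (S k)) (fun k => p (S k))). Qed.

Lemma copair_spec n : forall e (h : nat -> M) (a b : nat -> nat) (q : nat -> M),
  (forall k, q (a k) = e k) -> (forall k, q (b k) = h k) ->
  q (copair a b n) = join e h n.
Proof.
  revert n. fix IH 1. intros [|[|n]] e h a b q Ha Hb; simpl; auto.
Qed.

(** First-order definability with parameters: exactly what the separation scheme accepts. *)
Definition definable P :=
  exists f p, forall e, P e <-> sat (@mem M) (join e p) f.

(** An operation counts as definable when its graph is: value at index 0, arguments after it. *)
Definition dterm t := definable (fun e => e 0 = t (fun n => e (S n))).

Lemma definable_ext P Q : (forall e, P e <-> Q e) -> definable Q -> definable P.
Proof. intros H (f & p & K); exists f, p; intros e; rewrite H; apply K. Qed.

Lemma definable_rename P (r : nat -> nat) : definable P ->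
  definable (fun e => P (fun n => e (r n))).
Proof.
  intros (f & p & K). exists (rename (copair (fun n => even_slot (r n)) odd_slot) f), p.
  intros e. rewrite K. symmetry. apply sat_rename. intros n. apply copair_spec.
  - intros; apply join_even_slot.
  - intros; apply join_odd_slot.
Qed.

(** Two formulas may use different parameters; interleaving them gives one parameter
    environment that serves both, after which connectives act on formulas. *)
Lemma definable_common_parameters P Q : definable P -> definable Q -> exists f g p, forall e,
  (P e <-> sat (@mem M) (join e p) f) /\ (Q e <-> sat (@mem M) (join e p) g).
Proof.
  intros (f & p & K) (g & q & L).
  exists (rename (copair even_slot (fun n => odd_slot (even_slot n))) f),
    (rename (copair even_slot (fun n => odd_slot (odd_slot n))) g), (join p q).
  intros e; rewrite K, L; split; symmetry; apply sat_rename; intros n; apply copair_spec;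
  intros; rewrite ?join_even_slot, ?join_odd_slot, ?join_even_slot, ?join_odd_slot; auto.
Qed.

Lemma definable_and P Q : definable P -> definable Q -> definable (fun e => P e /\ Q e).
Proof.
  intros HP HQ; destruct (definable_common_parameters _ _ HP HQ) as (f & g & p & K).
  exists (FAnd f g), p; intros e; destruct (K e); simpl; tauto.
Qed.

Lemma definable_or P Q : definable P -> definable Q -> definable (fun e => P e \/ Q e).
Proof.
  intros HP HQ; destruct (definable_common_parameters _ _ HP HQ) as (f & g & p & K).
  exists (FOr f g), p; intros e; destruct (K e); simpl; tauto.
Qed.

Lemma definable_imp P Q : definable P -> definable Q -> definable (fun e => P e -> Q e).
Proof.
  intros HP HQ; destruct (definable_common_parameters _ _ HP HQ) as (f & g & p & K).
  exists (FImp f g), p; intros e; destruct (K e); simpl; tauto.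
Qed.

Lemma definable_false : definable (fun _ => False).
Proof. exists FBot, (fun _ => any_set); intros; simpl; tauto. Qed.

(** A quantifier binds index 0 of the joined environment, whereas [push] on the variables
    shifts only the even indices; a renaming reconciles the two. *)
Lemma sat_push_join (f : formula) : exists g, forall x e p,
  sat (@mem M) (push x (join e p)) g <-> sat (@mem M) (join (push x e) p) f.
Proof.
  exists (rename (copair (fun n => match n with O => O | S m => S (even_slot m) end)
    (fun n => S (odd_slot n))) f).
  intros; apply sat_rename; intros n; apply copair_spec.
  - intros [|k]; simpl; auto. apply join_even_slot.
  - intros k; apply join_odd_slot.
Qed.

Lemma definable_ex (Q : (nat -> M) -> M -> Prop) :
  definable (fun e => Q (fun n => e (S n)) (e 0)) -> definable (fun e => exists x, Q e x).
Proof.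
  intros (f & p & K). destruct (sat_push_join f) as [g G]. exists (FEx g), p; intros e; simpl.
  split; intros [x H]; exists x; revert H; rewrite G, <- K; exact (fun x => x).
Qed.

Lemma definable_all (Q : (nat -> M) -> M -> Prop) :
  definable (fun e => Q (fun n => e (S n)) (e 0)) -> definable (fun e => forall x, Q e x).
Proof.
  intros (f & p & K). destruct (sat_push_join f) as [g G]. exists (FAll g), p; intros e; simpl.
  split; intros H x; specialize (H x); revert H; rewrite G, <- K; exact (fun x => x).
Qed.

Lemma dterm_var k : dterm (fun e => e k).
Proof.
  exists (FEq (even_slot 0) (even_slot (S k))), (fun _ => any_set).
  intros e. change (e 0 = e (S k) <->
    join e (fun _ => any_set) (even_slot 0) = join e (fun _ => any_set) (even_slot (S k))).
  rewrite !join_even_slot; tauto.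
Qed.

Lemma dterm_const c : dterm (fun _ => c).
Proof. exists (FEq 0 1), (fun _ => c). intros e; simpl; tauto. Qed.

Lemma definable_eq_var i j : definable (fun e => e i = e j).
Proof. exact (definable_rename _ (fun n => match n with O => i | _ => j end) (dterm_var 0)). Qed.

Lemma definable_mem_var i j : definable (fun e => e i ∈ e j).
Proof.
  refine (definable_rename (fun e => e 0 ∈ e 1) (fun n => match n with O => i | _ => j end) _).
  exists (FMem 0 2), (fun _ => any_set).
  intros e; simpl; tauto.
Qed.

(** A defined term [t] is eliminated by quantifying over its value. *)
Lemma definable_subst (Q : (nat -> M) -> M -> Prop) t : dterm t ->
  definable (fun e => Q (fun n => e (S n)) (e 0)) -> definable (fun e => Q e (t e)).
Proof.
  intros Ht HQ. apply definable_ext with (fun e => exists x, x = t e /\ Q e x).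
  - intros e; split; [intros H; exists (t e); auto | intros [x [-> H]]; auto].
  - apply definable_ex. apply definable_and; auto.
Qed.

Lemma dterm_rename t (r : nat -> nat) : dterm t -> dterm (fun e => t (fun n => e (r n))).
Proof. intros H. exact (definable_rename _ (fun n => match n with O => O | S m => S (r m) end) H).
  Qed.

(** Registered definable relations and operations, so that compound ones are recognized
    without unfolding them down to membership. *)
Class Rel1 (P : M -> Prop) := rel1 : definable (fun e => P (e 0)).
Class Rel2 (P : M -> M -> Prop) := rel2 : definable (fun e => P (e 0) (e 1)).
Class Rel3 (P : M -> M -> M -> Prop) := rel3 : definable (fun e => P (e 0) (e 1) (e 2)).
Class Rel4 (P : M -> M -> M -> M -> Prop) := rel4 : definable (fun e => P (e 0) (e 1) (e 2) (e 3)).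
Class Fun1 (F : M -> M) := fun1 : dterm (fun e => F (e 0)).
Class Fun2 (F : M -> M -> M) := fun2 : dterm (fun e => F (e 0) (e 1)).
Class Fun3 (F : M -> M -> M -> M) := fun3 : dterm (fun e => F (e 0) (e 1) (e 2)).

Lemma definable_rel1 R t : Rel1 R -> dterm t -> definable (fun e => R (t e)).
Proof.
  intros HR Ht. apply (definable_subst (fun _ x => R x) t); auto.
Qed.

Lemma definable_rel2 R t u : Rel2 R -> dterm t -> dterm u -> definable (fun e => R (t e) (u e)).
Proof.
  intros HR Ht Hu. apply (definable_subst (fun e x => R x (u e)) t); auto.
  apply (definable_subst (fun e y => R (e 0) y) (fun e => u (fun n => e (S n)))).
  - apply dterm_rename; auto.
  - exact (definable_rename _ (fun n => match n with O => 1 | _ => O end) HR).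
Qed.

Lemma definable_rel3 R t u v : Rel3 R -> dterm t -> dterm u -> dterm v ->
  definable (fun e => R (t e) (u e) (v e)).
Proof.
  intros HR Ht Hu Hv. apply (definable_subst (fun e x => R x (u e) (v e)) t); auto.
  apply (definable_subst (fun e y => R (e 0) y (v (fun n => e (S n))))
    (fun e => u (fun n => e (S n)))).
  - apply dterm_rename; auto.
  - apply (definable_subst (fun e y => R (e 1) (e 0) y) (fun e => v (fun n => e (S (S n))))).
    + exact (dterm_rename v (fun n => S (S n)) Hv).
    + exact (definable_rename _ (fun n => match n with O => 2 | S O => 1 | _ => O end) HR).
Qed.

Lemma definable_rel4 R t u v w : Rel4 R -> dterm t -> dterm u -> dterm v -> dterm w ->
  definable (fun e => R (t e) (u e) (v e) (w e)).
Proof.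
  intros HR Ht Hu Hv Hw. apply (definable_subst (fun e x => R x (u e) (v e) (w e)) t); auto.
  apply (definable_subst (fun e y => R (e 0) y (v (fun n => e (S n))) (w (fun n => e (S n))))
    (fun e => u (fun n => e (S n)))).
  - apply dterm_rename; auto.
  - apply (definable_subst (fun e y => R (e 1) (e 0) y (w (fun n => e (S (S n)))))
      (fun e => v (fun n => e (S (S n))))).
    + exact (dterm_rename v (fun n => S (S n)) Hv).
    + apply (definable_subst (fun e y => R (e 2) (e 1) (e 0) y)
        (fun e => w (fun n => e (S (S (S n)))))).
      * exact (dterm_rename w (fun n => S (S (S n))) Hw).
      * exact (definable_rename _ (fun n => match n with O => 3 | S O => 2 | S
          (S O) => 1 | _ => O end) HR).
Qed.

Lemma dterm_fun1 F t : Fun1 F -> dterm t -> dterm (fun e => F (t e)).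
Proof.
  intros HF Ht. apply (definable_rel2 (fun y x => y = F x) (fun e => e 0)
    (fun e => t (fun n => e (S n)))).
  - exact HF.
  - apply dterm_var.
  - apply dterm_rename; auto.
Qed.

Lemma dterm_fun2 F t u : Fun2 F -> dterm t -> dterm u -> dterm (fun e => F (t e) (u e)).
Proof.
  intros HF Ht Hu.
  apply (definable_rel3 (fun y x z => y = F x z) (fun e => e 0) (fun e => t (fun n => e (S n)))
    (fun e => u (fun n => e (S n)))).
  - exact HF.
  - apply dterm_var.
  - apply dterm_rename; auto.
  - apply dterm_rename; auto.
Qed.

Lemma dterm_fun3 F t u v : Fun3 F -> dterm t -> dterm u -> dterm v ->
  dterm (fun e => F (t e) (u e) (v e)).
Proof.
  intros HF Ht Hu Hv.
  apply (definable_rel4 (fun y x z w => y = F x z w) (fun e => e 0) (fun e => t (fun n => e (S n)))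
    (fun e => u (fun n => e (S n))) (fun e => v (fun n => e (S n)))).
  - exact HF.
  - apply dterm_var.
  - apply dterm_rename; auto.
  - apply dterm_rename; auto.
  - apply dterm_rename; auto.
Qed.

Lemma definable_eq t u : dterm t -> dterm u -> definable (fun e => t e = u e).
Proof. apply (definable_rel2 (fun x y => x = y)). apply (definable_eq_var 0 1). Qed.

Lemma definable_mem t u : dterm t -> dterm u -> definable (fun e => t e ∈ u e).
Proof. apply (definable_rel2 mem). apply (definable_mem_var 0 1). Qed.

(** The parameters are free variables of the formula, listed after the separated variable. *)
Lemma separation (P : M -> Prop) (a : M) : Rel1 P -> exists c, forall x, x ∈ c <-> x ∈ a /\ P x.
Proof.
  intros (f & p & K).
  destruct (zf_separation M (rename (copair (fun _ => 0) S) f) p a) as [c C].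
  exists c; intros x; rewrite C, (K (fun _ => x)).
  rewrite (sat_rename f _ (push x p) (join (fun _ => x) p)); [tauto|].
  intros n; apply copair_spec; auto.
Qed.

Lemma ext (a b : M) : (forall x, x ∈ a <-> x ∈ b) -> a = b.
Proof. apply zf_extensionality. Qed.

Lemma exists_empty : exists z : M, is_empty z.
Proof. destruct (zf_infinity M) as (a & (z & _ & H) & _); exists z; exact H. Qed.

(** The default value, the empty set, makes description total, and it is itself definable
    ([the_spec]); hence every operation introduced by a description remains definable,
    including those with a predicate among its arguments such as [sep]. *)
Definition the (P : M -> Prop) : M :=
  epsilon sets_inhabited
    (fun y => (P y /\ forall z, P z -> z = y) \/
              (~ (exists y, P y /\ forall z, P z -> z = y) /\ is_empty y)).

Lemma the_spec (P : M -> Prop) y : y = the P <-> (P y /\ forall z, P z -> z = y) \/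
              (~ (exists y, P y /\ forall z, P z -> z = y) /\ is_empty y).
Proof.
  assert (H : (P (the P) /\ forall z, P z -> z = the P) \/
              (~ (exists y, P y /\ forall z, P z -> z = y) /\ is_empty (the P))).
  { unfold the. apply epsilon_spec.
    destruct (classic (exists y, P y /\ forall z, P z -> z = y)) as [[z H]|H].
    - exists z; auto.
    - destruct exists_empty as [z E]; exists z; auto. }
  split; [intros ->; auto|].
  intros [[K1 K2]|[K1 K2]]; destruct H as [[H1 H2]|[H1 H2]].
  - apply H2; auto.
  - exfalso; apply H1; eauto.
  - exfalso; apply K1; eauto.
  - apply ext; intros x; split; intros Hx; [destruct (K2 x)|destruct (H2 x)]; auto.
Qed.

Lemma the_in (P : M -> Prop) : (exists y, P y) -> (forall y z, P y -> P z -> y = z) -> P (the P).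
Proof.
  intros [y Hy] U. assert (y = the P) as <-; auto.
  apply the_spec; left; split; auto.
Qed.

Lemma the_eq (P : M -> Prop) y : P y -> (forall z, P z -> z = y) -> the P = y.
Proof. intros; symmetry; apply the_spec; auto. Qed.

Lemma definable_not P : definable P -> definable (fun e => ~ P e).
Proof. intros; apply definable_imp; auto using definable_false. Qed.

Lemma definable_equiv P Q : definable P -> definable Q -> definable (fun e => P e <-> Q e).
Proof. intros; apply definable_and; apply definable_imp; auto. Qed.

Lemma dterm_the (Q : (nat -> M) -> M -> Prop) :
  definable (fun e => Q (fun n => e (S n)) (e 0)) -> dterm (fun e => the (Q e)).
Proof.
  intros H. unfold dterm. eapply definable_ext. { intros e; apply the_spec. }
  assert (U : definable (fun e => Q (fun n => e (S n)) (e 0) /\ forall z, Q (fun n => e (S n)) z ->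
    z = e 0)).
  { apply definable_and; auto. apply definable_all. apply definable_imp.
    - exact (definable_rename _ (fun n => match n with O => O | S m => S (S m) end) H).
    - apply definable_eq; apply dterm_var. }
  apply definable_or; auto. apply definable_and.
  - apply definable_not. apply (definable_rename (fun e => exists y, Q e y /\ forall z, Q e z ->
      z = y) S).
    apply definable_ex; auto.
  - apply definable_all. apply definable_not. apply (definable_mem_var 0 1).
Qed.

Definition sep (a : M) (P : M -> Prop) : M := the (fun c => forall x, x ∈ c <-> x ∈ a /\ P x).

Lemma in_sep a (P : M -> Prop) x : Rel1 P -> x ∈ sep a P <-> x ∈ a /\ P x.
Proof.
  intros HP. revert x. change ((fun c => forall x, x ∈ c <-> x ∈ a /\ P x) (sep a P)).
  apply the_in. { apply separation; auto. }
  intros y z Hy Hz; apply ext; intros x; rewrite Hy, Hz; tauto.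
Qed.

Lemma dterm_sep t (Q : (nat -> M) -> M -> Prop) : dterm t ->
  definable (fun e => Q (fun n => e (S n)) (e 0)) -> dterm (fun e => sep (t e) (Q e)).
Proof.
  intros Ht HQ. apply dterm_the. apply definable_all. apply definable_equiv.
    { apply (definable_mem_var 0 1). }
  apply definable_and.
  - apply definable_mem. { apply (dterm_var 0). } exact (dterm_rename t (fun n => S (S n)) Ht).
  - exact (definable_rename _ (fun n => match n with O => O | S m => S (S m) end) HQ).
Qed.

End Definability.

(** The head constant of the body of [L], found by instantiating the environment. *)
Ltac head_of L :=
  let rec go c := lazymatch c with ?f _ => go f | _ => c end in
  lazymatch type of L with
  | (nat -> sets ?M) -> _ =>
      let b := eval cbv beta in (L (fun _ => @the M (fun _ => False))) in go b
  end.

(** Proves definability by following the syntax: logical connectives, atoms, registered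
    relations and operations, and the unfolding of every other constant. *)
Ltac dfn_step :=
  cbv beta;
  lazymatch goal with
  | |- Rel1 _ => unfold Rel1
  | |- Rel2 _ => unfold Rel2
  | |- Rel3 _ => unfold Rel3
  | |- Rel4 _ => unfold Rel4
  | |- Fun1 _ => unfold Fun1
  | |- Fun2 _ => unfold Fun2
  | |- Fun3 _ => unfold Fun3
  | |- definable (fun e => @?P e /\ @?Q e) => apply (definable_and P Q)
  | |- definable (fun e => @?P e \/ @?Q e) => apply (definable_or P Q)
  | |- definable (fun e => @?P e <-> @?Q e) => apply (definable_equiv P Q)
  | |- definable (fun e => ~ @?P e) => apply (definable_not P)
  | |- definable (fun e => exists x, @?Q e x) => apply (definable_ex Q)
  | |- definable (fun e => @ex _ (@unique _ _)) => unfold unique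
  | |- definable (fun e => @eq _ (@?t e) (@?u e)) => apply (definable_eq t u)
  | |- definable (fun e => @mem _ (@?t e) (@?u e)) => apply (definable_mem t u)
  | |- definable (fun e => False) => apply definable_false
  (* the pattern also matches an implication, which is not a quantifier over sets *)
  | |- definable (fun e => forall x, @?Q e x) =>
       first [ apply (definable_all Q) |
         lazymatch goal with |- definable (fun e => @?A e -> @?B e) => apply
           (definable_imp A B) end ]
  | |- dterm (fun e => e ?k) => apply (dterm_var k)
  | |- dterm (fun _ => ?c) => apply (dterm_const c)
  | |- dterm (fun e => the (@?Q e)) => apply (dterm_the Q)
  | |- dterm (fun e => sep (@?t e) (@?Q e)) => apply (dterm_sep t Q)
  | |- dterm _ =>
      first
      [ match goal with |- dterm (fun e => ?F (@?a e)) =>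
          let H := constr:(_ : Fun1 F) in apply (dterm_fun1 F a H) end
      | match goal with |- dterm (fun e => ?F (@?a e) (@?b e)) =>
          let H := constr:(_ : Fun2 F) in apply (dterm_fun2 F a b H) end
      | match goal with |- dterm (fun e => ?F (@?a e) (@?b e) (@?c e)) =>
          let H := constr:(_ : Fun3 F) in apply (dterm_fun3 F a b c H) end
      | match goal with |- dterm ?L =>
          let h := head_of L in unfold h end ]
  | |- definable _ =>
      first
      [ match goal with |- definable (fun e => ?F (@?a e)) =>
          let H := constr:(_ : Rel1 F) in apply (definable_rel1 F a H) end
      | match goal with |- definable (fun e => ?F (@?a e) (@?b e)) =>
          let H := constr:(_ : Rel2 F) in apply (definable_rel2 F a b H) end
      | match goal with |- definable (fun e => ?F (@?a e) (@?b e) (@?c e)) =>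
          let H := constr:(_ : Rel3 F) in apply (definable_rel3 F a b c H) end
      | match goal with |- definable (fun e => ?F (@?a e) (@?b e) (@?c e) (@?d e)) =>
          let H := constr:(_ : Rel4 F) in apply (definable_rel4 F a b c d H) end
      | match goal with |- definable ?L =>
          let h := head_of L in unfold h end ]
  end.
Ltac dfn := repeat dfn_step.

#[global] Hint Extern 5 (Rel1 (fun _ => _)) => solve [dfn] : typeclass_instances.
#[global] Hint Extern 5 (Rel2 (fun _ => _)) => solve [dfn] : typeclass_instances.
#[global] Hint Extern 5 (Rel3 (fun _ => _)) => solve [dfn] : typeclass_instances.
#[global] Hint Extern 5 (Fun1 (fun _ => _)) => solve [dfn] : typeclass_instances.
#[global] Hint Extern 5 (Fun2 (fun _ => _)) => solve [dfn] : typeclass_instances.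
#[global] Hint Extern 5 (Fun3 (fun _ => _)) => solve [dfn] : typeclass_instances.

(** * Elementary set theory without choice *)

Section Sets.
Context {M : ZF}.
Implicit Types (a b c x y z n m f g : M).

Definition upair a b : M := the (fun c => forall x, x ∈ c <-> x = a \/ x = b).
Definition sing a : M := upair a a.
Definition pair a b : M := upair (sing a) (upair a b).
Definition union a : M := the (fun c => forall x, x ∈ c <-> exists b, b ∈ a /\ x ∈ b).
Definition cup a b : M := union (upair a b).
Definition pow a : M := the (fun c => forall x, x ∈ c <-> x ⊆ a).
Definition empty : M := the (fun c => forall x, ~ x ∈ c).
Definition succ n : M := cup n (sing n).
Definition omega : M := the (fun c => forall x, x ∈ c <-> is_nat x).
Definition prod a b : M :=
  sep (pow (pow (cup a b))) (fun p => exists x y, x ∈ a /\ y ∈ b /\ p = pair x y).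
Definition ap f x : M := the (fun y => app f x y).
Definition lam a b (F : M -> M) : M := sep (prod a b) (fun p => exists x, p = pair x (F x)).
Definition ite (P : Prop) a b : M := the (fun z => (P /\ z = a) \/ (~ P /\ z = b)).

#[global] Instance rel_subset : Rel2 (@subset M). Proof. dfn. Qed.
#[global] Instance rel_is_pair : Rel3 (@is_pair M). Proof. dfn. Qed.
#[global] Instance rel_app : Rel3 (@app M). Proof. dfn. Qed.
#[global] Instance rel_is_nat : Rel1 (@is_nat M). Proof. dfn. Qed.
#[global] Instance rel_is_fun : Rel3 (@is_fun M). Proof. dfn. Qed.
#[global] Instance rel_equip : Rel2 (@equipotent M). Proof. dfn. Qed.
#[global] Instance fun_upair : Fun2 upair. Proof. dfn. Qed.
#[global] Instance fun_sing : Fun1 sing. Proof. dfn. Qed.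
#[global] Instance fun_pair : Fun2 pair. Proof. dfn. Qed.
#[global] Instance fun_union : Fun1 union. Proof. dfn. Qed.
#[global] Instance fun_cup : Fun2 cup. Proof. dfn. Qed.
#[global] Instance fun_pow : Fun1 pow. Proof. dfn. Qed.
#[global] Instance fun_succ : Fun1 succ. Proof. dfn. Qed.
#[global] Instance fun_prod : Fun2 prod. Proof. dfn. Qed.
#[global] Instance fun_ap : Fun2 ap. Proof. dfn. Qed.

Lemma the_members (P : M -> Prop) :
  (exists c, forall x, x ∈ c <-> P x) ->
  forall x, x ∈ the (fun c => forall x, x ∈ c <-> P x) <-> P x.
Proof.
  intros H. apply (the_in (fun c => forall x, x ∈ c <-> P x)); auto.
  intros y z Hy Hz; apply ext; intros x; rewrite Hy, Hz; tauto.
Qed.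

Lemma in_upair a b x : x ∈ upair a b <-> x = a \/ x = b.
Proof. revert x; apply the_members, zf_pairing. Qed.

Lemma in_sing a x : x ∈ sing a <-> x = a.
Proof. unfold sing; rewrite in_upair; tauto. Qed.

Lemma in_union a x : x ∈ union a <-> exists b, b ∈ a /\ x ∈ b.
Proof. revert x; apply the_members, zf_union. Qed.

Lemma in_cup a b x : x ∈ cup a b <-> x ∈ a \/ x ∈ b.
Proof.
  unfold cup; rewrite in_union; split.
  - intros (c & Hc & Hx); apply in_upair in Hc as [-> | ->]; auto.
  - intros [H|H]; [exists a|exists b]; rewrite in_upair; auto.
Qed.

Lemma in_pow a x : x ∈ pow a <-> x ⊆ a.
Proof. revert x; apply the_members. destruct (zf_power M a) as [c C]; exists c; exact C. Qed.

Lemma in_empty x : ~ x ∈ empty.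
Proof.
  revert x. apply (the_in (fun c => forall x, ~ x ∈ c)). { apply exists_empty. }
  intros y z Hy Hz; apply ext; intros x; split; intros K; [destruct (Hy x)|destruct (Hz x)]; auto.
Qed.

Lemma is_empty_iff a : is_empty a <-> a = empty.
Proof.
  split; [|intros -> x; apply in_empty].
  intros H; apply ext; intros x; split; intros K; [destruct (H x)|destruct (in_empty x)]; auto.
Qed.

Lemma empty_or_inhabited a : a = empty \/ exists x, x ∈ a.
Proof.
  destruct (classic (exists x, x ∈ a)) as [H|H]; auto. left.
  apply is_empty_iff. intros x Hx; eauto.
Qed.

Lemma in_succ n x : x ∈ succ n <-> x ∈ n \/ x = n.
Proof. unfold succ; rewrite in_cup, in_sing; tauto. Qed.

Lemma is_succ_iff n m : is_succ n m <-> m = succ n.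
Proof.
  split.
  - intros H; apply ext; intros x; rewrite in_succ; apply H.
  - intros -> x; apply in_succ.
Qed.

Lemma is_upair_iff c a b : is_upair c a b <-> c = upair a b.
Proof.
  split.
  - intros H; apply ext; intros x; rewrite in_upair; apply H.
  - intros -> x; apply in_upair.
Qed.

Lemma is_pair_iff p x y : is_pair p x y <-> p = pair x y.
Proof.
  split.
  - intros (s & u & Hs & Hu & Hp); apply is_upair_iff in Hs, Hu, Hp; subst; reflexivity.
  - intros ->; exists (sing x), (upair x y); rewrite !is_upair_iff; auto.
Qed.

Lemma pair_inj x y x' y' : pair x y = pair x' y' -> x = x' /\ y = y'.
Proof.
  intros H.
  assert (K : forall z, z ∈ pair x y <-> z ∈ pair x' y') by (rewrite H; tauto).
  unfold pair in K.
  assert (E1 : x = x').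
  { assert (K1 : sing x' ∈ upair (sing x) (upair x y)) by (apply K, in_upair; auto).
    apply in_upair in K1 as [K1|K1].
    - symmetry; apply in_sing; rewrite <- K1; apply in_sing; auto.
    - apply in_sing; rewrite K1; apply in_upair; auto. }
  subst x'; split; auto.
  assert (K1 : upair x y ∈ upair (sing x) (upair x y')) by (apply K, in_upair; auto).
  assert (K2 : upair x y' ∈ upair (sing x) (upair x y)) by (apply K, in_upair; auto).
  assert (Y1 : y = x \/ y = y').
  { apply in_upair in K1 as [K1|K1].
    - left; apply in_sing; rewrite <- K1; apply in_upair; auto.
    - apply in_upair; rewrite <- K1; apply in_upair; auto. }
  assert (Y2 : y' = x \/ y' = y).
  { apply in_upair in K2 as [K2|K2].
    - left; apply in_sing; rewrite <- K2; apply in_upair; auto.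
    - apply in_upair; rewrite <- K2; apply in_upair; auto. }
  destruct Y1, Y2; congruence.
Qed.

Lemma in_prod a b p : p ∈ prod a b <-> exists x y, x ∈ a /\ y ∈ b /\ p = pair x y.
Proof.
  unfold prod; rewrite in_sep by apply _.
  split; [tauto|]. intros (x & y & Hx & Hy & ->); split; [|eauto].
  apply in_pow; intros u Hu; apply in_pow; intros z Hz; apply in_cup.
  apply in_upair in Hu as [-> | ->]; apply in_upair in Hz as [-> | ->]; auto.
Qed.

Lemma pair_in_prod a b x y : pair x y ∈ prod a b <-> x ∈ a /\ y ∈ b.
Proof.
  rewrite in_prod; split; [|intros [? ?]; eauto].
  intros (x' & y' & Hx & Hy & E); apply pair_inj in E as [-> ->]; auto.
Qed.

Lemma is_prod_iff c a b : is_prod c a b <-> c = prod a b.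
Proof.
  split.
  - intros H; apply ext; intros p; rewrite in_prod; rewrite (H p).
    split; intros (x & y & Hx & Hy & E); exists x, y;
      [rewrite is_pair_iff in E|rewrite is_pair_iff]; auto.
  - intros -> p; rewrite in_prod.
    split; intros (x & y & Hx & Hy & E); exists x, y;
      [rewrite is_pair_iff|rewrite is_pair_iff in E]; auto.
Qed.

Lemma app_iff f x y : app f x y <-> pair x y ∈ f.
Proof.
  unfold app; split.
  - intros (p & Hp & H); apply is_pair_iff in Hp as ->; auto.
  - intros H; exists (pair x y); rewrite is_pair_iff; auto.
Qed.

Lemma app2_iff f x y z : app2 f x y z <-> app f (pair x y) z.
Proof.
  unfold app2; split.
  - intros (p & Hp & H); apply is_pair_iff in Hp as ->; auto.
  - intros H; exists (pair x y); rewrite is_pair_iff; auto.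
Qed.

(** * Functions as sets *)

Lemma fun_app f a b x y : is_fun f a b -> x ∈ a -> (app f x y <-> y = ap f x).
Proof.
  intros [_ H] Hx; destruct (H x Hx) as (z & Hz & U).
  assert (E : ap f x = z) by (apply the_eq; auto; intros; symmetry; auto).
  rewrite E; split; [intros K; symmetry; auto|intros ->; auto].
Qed.

Lemma app_dom f a b x y : is_fun f a b -> app f x y -> x ∈ a /\ y ∈ b.
Proof.
  intros [H _] K; apply app_iff in K; apply H in K as (x' & y' & Hx & Hy & E).
  apply is_pair_iff, pair_inj in E as [-> ->]; auto.
Qed.

Lemma app_ap f a b x : is_fun f a b -> x ∈ a -> app f x (ap f x).
Proof. intros Hf Hx; apply (fun_app f a b); auto. Qed.

Lemma fun_in f a b x : is_fun f a b -> x ∈ a -> ap f x ∈ b.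
Proof. intros Hf Hx; apply (app_dom f a b x); auto; eapply app_ap; eauto. Qed.

Lemma fun_weaken f a b c : is_fun f a b -> (forall x, x ∈ a -> ap f x ∈ c) -> is_fun f a c.
Proof.
  intros Hf H; split; [|apply Hf].
  intros p Hp; destruct (proj1 Hf p Hp) as (x & y & Hx & Hy & E); exists x, y.
  assert (y = ap f x) as ->. { apply (fun_app f a b); auto. exists p; auto. }
  auto.
Qed.

Lemma lam_fun a b F : Fun1 F -> (forall x, x ∈ a -> F x ∈ b) -> is_fun (lam a b F) a b.
Proof.
  intros HF H. split.
  - intros p Hp; unfold lam in Hp; rewrite in_sep in Hp by apply _.
    destruct Hp as [Hp _]; apply in_prod in Hp as (x & y & Hx & Hy & E).
    exists x, y; rewrite is_pair_iff; auto.
  - intros x Hx; exists (F x); split.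
    + apply app_iff; unfold lam; rewrite in_sep by apply _; rewrite pair_in_prod; eauto.
    + intros y Hy; apply app_iff in Hy; unfold lam in Hy; rewrite in_sep in Hy by apply _.
      destruct Hy as [_ [x' E]]; apply pair_inj in E as [-> ->]; auto.
Qed.

Lemma lam_ap a b F x : Fun1 F -> (forall x, x ∈ a -> F x ∈ b) -> x ∈ a -> ap (lam a b F) x = F x.
Proof.
  intros HF H Hx. symmetry. apply (fun_app (lam a b F) a b); auto using lam_fun.
  apply app_iff; unfold lam; rewrite in_sep by apply _; rewrite pair_in_prod; eauto.
Qed.

Lemma ite_true (P : Prop) a b : P -> ite P a b = a.
Proof. intros H; apply the_eq; [auto|intros z [[_ K]|[K _]]; tauto]. Qed.

Lemma ite_false (P : Prop) a b : ~ P -> ite P a b = b.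
Proof. intros H; apply the_eq; [auto|intros z [[K _]|[_ K]]; tauto]. Qed.

Lemma equip_intro a b F : Fun1 F -> (forall x, x ∈ a -> F x ∈ b) ->
  (forall x x', x ∈ a -> x' ∈ a -> F x = F x' -> x = x') ->
  (forall y, y ∈ b -> exists x, x ∈ a /\ F x = y) -> equipotent a b.
Proof.
  intros HF H I S. exists (lam a b F). pose proof (lam_fun a b F HF H) as L. split; auto.
  intros y Hy; destruct (S y Hy) as (x & Hx & E); exists x; split.
  - apply (fun_app _ a b); auto. rewrite lam_ap; auto.
  - intros x' K; pose proof (app_dom _ _ _ _ _ L K) as [Hx' _].
    apply (fun_app _ a b) in K; auto. rewrite lam_ap in K; auto. subst; auto.
Qed.

Lemma equip_elim a b : equipotent a b -> exists f, is_fun f a b /\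
  (forall x x', x ∈ a -> x' ∈ a -> ap f x = ap f x' -> x = x') /\
  (forall y, y ∈ b -> exists x, x ∈ a /\ ap f x = y).
Proof.
  intros (f & Hf & S); exists f; split; auto; split.
  - intros x x' Hx Hx' E.
    destruct (S (ap f x)) as (z & Hz & U). { eapply fun_in; eauto. }
    transitivity z; [symmetry|]; apply U; [|rewrite E]; eapply app_ap; eauto.
  - intros y Hy; destruct (S y Hy) as (x & Hx & _).
    exists x; pose proof (app_dom _ _ _ _ _ Hf Hx) as [K _]; split; auto.
    symmetry; apply (fun_app f a b); auto.
Qed.

(** * Natural numbers and recursion *)

Lemma mem_irrefl x : ~ x ∈ x.
Proof.
  intros H. destruct (zf_foundation M (sing x)) as (y & Hy & K). { exists x; apply in_sing; auto. }
  apply in_sing in Hy as ->. apply (K x H), in_sing; auto.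
Qed.

Lemma nat_empty : is_nat empty.
Proof. intros a [(z & Hz & H) _]. apply is_empty_iff in Hz as ->; auto. Qed.

Lemma nat_succ n : is_nat n -> is_nat (succ n).
Proof. intros H a Ha; apply (proj2 Ha n); auto. apply is_succ_iff; auto. Qed.

Lemma in_omega n : n ∈ omega <-> is_nat n.
Proof.
  revert n; apply the_members.
  destruct (zf_infinity M) as (a & (z & Hz & Ez) & Hs).
  assert (I : inductive a).
  { split; [exists z; auto|]. intros n m Hn Hm; destruct (Hs n Hn) as (y & Hy & E).
    assert (m = y) as ->; auto. apply ext; intros x; rewrite (Hm x), (E x); tauto. }
  exists (sep a is_nat); intros x; rewrite in_sep by apply _. split; [tauto|]. intros K; split;
    auto.
Qed.

Lemma is_omega_iff w : is_omega w <-> w = omega.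
Proof.
  split; [|intros -> x; apply in_omega].
  intros H; apply ext; intros x; rewrite in_omega; apply H.
Qed.

Lemma is_seq_iff s a : is_seq s a <-> is_fun s omega a.
Proof.
  unfold is_seq; split.
  - intros (w & Hw & H); apply is_omega_iff in Hw as ->; auto.
  - intros H; exists omega; rewrite is_omega_iff; auto.
Qed.

(** [omega] may be nonstandard, so induction is available for definable predicates only. *)
Lemma nat_induction (P : M -> Prop) : Rel1 P -> P empty ->
  (forall n, is_nat n -> P n -> P (succ n)) -> forall n, is_nat n -> P n.
Proof.
  intros HP H0 HS n Hn.
  enough (K : n ∈ sep omega P) by (rewrite in_sep in K by auto; tauto).
  apply Hn. split.
  - exists empty; rewrite is_empty_iff, in_sep, in_omega by auto; auto using nat_empty.
  - intros k m Hk Hm; apply is_succ_iff in Hm as ->.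
    rewrite in_sep, in_omega in * by auto. destruct Hk; auto using nat_succ.
Qed.

Lemma nat_trans_all n : is_nat n -> forall x, x ∈ n -> is_nat x /\ x ⊆ n.
Proof.
  revert n; apply (nat_induction (fun n => forall x, x ∈ n -> is_nat x /\ x ⊆ n)); [apply _| |].
  - intros x Hx; destruct (in_empty x); auto.
  - intros n Hn IH x Hx; apply in_succ in Hx as [Hx| ->].
    + destruct (IH x Hx); split; auto. intros z Hz; apply in_succ; auto.
    + split; auto. intros z Hz; apply in_succ; auto.
Qed.

Lemma nat_mem_trans n x y : is_nat n -> x ∈ n -> y ∈ x -> y ∈ n.
Proof. intros Hn Hx Hy; apply (proj2 (nat_trans_all n Hn x Hx)); auto. Qed.

Lemma nat_cases n : is_nat n -> n = empty \/ exists m, is_nat m /\ n = succ m.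
Proof.
  revert n; apply (nat_induction (fun n => n = empty \/ exists m, is_nat m /\ n = succ m));
    [apply _|auto|eauto].
Qed.

Lemma succ_inj n m : is_nat n -> is_nat m -> succ n = succ m -> n = m.
Proof.
  intros Hn Hm E.
  assert (K : n ∈ succ m) by (rewrite <- E; apply in_succ; auto).
  assert (L : m ∈ succ n) by (rewrite E; apply in_succ; auto).
  apply in_succ in K as [K|K]; auto. apply in_succ in L as [L|L]; auto.
  destruct (mem_irrefl n). eapply nat_mem_trans; [|exact L|]; auto.
Qed.

Lemma succ_neq_empty n : succ n <> empty.
Proof. intros E; apply (in_empty n); rewrite <- E; apply in_succ; auto. Qed.

Lemma succ_le m : is_nat m -> forall n, n ∈ m -> succ n = m \/ succ n ∈ m.
Proof.
  revert m; apply (nat_induction (fun m => forall n, n ∈ m -> succ n = m \/ succ n ∈ m));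
    [apply _| |].
  - intros n H; destruct (in_empty n); auto.
  - intros m Hm IH n Hn; apply in_succ in Hn as [Hn| ->]; auto. right.
    apply in_succ. destruct (IH n Hn) as [<-|]; auto.
Qed.

Lemma nat_trichotomy n m : is_nat n -> is_nat m -> n ∈ m \/ n = m \/ m ∈ n.
Proof.
  intros Hn; revert m; revert n Hn.
  apply (nat_induction (fun n => forall m, is_nat m -> n ∈ m \/ n = m \/ m ∈ n)); [apply _| |].
  - apply (nat_induction (fun m => empty ∈ m \/ empty = m \/ m ∈ empty)); [apply _|auto|].
    intros m Hm [H|[H|H]]; rewrite in_succ; auto. destruct (in_empty m); auto.
  - intros n Hn IH m Hm; rewrite in_succ. destruct (IH m Hm) as [H|[H|H]]; auto.
    destruct (succ_le m Hm n H); auto.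
Qed.

Lemma nat_le_iff n m : is_nat n -> is_nat m -> n ⊆ m <-> n ∈ m \/ n = m.
Proof.
  intros Hn Hm; split.
  - intros H; destruct (nat_trichotomy n m Hn Hm) as [K|[K|K]]; auto.
    destruct (mem_irrefl m); auto.
  - intros [H| ->]; [|intros x; auto]. apply nat_trans_all; auto.
Qed.

Lemma nat_le_total n m : is_nat n -> is_nat m -> n ⊆ m \/ m ∈ n.
Proof. intros Hn Hm; rewrite nat_le_iff by auto; destruct (nat_trichotomy n m Hn Hm); tauto. Qed.

Lemma nat_max n m : is_nat n -> is_nat m -> exists k, is_nat k /\ n ⊆ k /\ m ⊆ k.
Proof.
  intros Hn Hm; destruct (nat_le_total n m Hn Hm) as [H|H].
  - exists m; repeat split; auto. intros x; auto.
  - exists n; repeat split; auto. { intros x; auto. } apply nat_trans_all; auto.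
Qed.

Lemma nat_least (P : M -> Prop) : Rel1 P -> (exists n, is_nat n /\ P n) ->
  exists n, is_nat n /\ P n /\ forall m, is_nat m -> P m -> ~ m ∈ n.
Proof.
  intros HP (n & Hn & H).
  destruct (zf_foundation M (sep omega P)) as (k & Hk & L).
  { exists n; rewrite in_sep, in_omega by auto; auto. }
  rewrite in_sep, in_omega in Hk by auto. exists k; repeat split; try apply Hk.
  intros m Hm Pm Hmk; apply (L m Hmk). rewrite in_sep, in_omega by auto; auto.
Qed.

(** The least set of pairs that contains (0, a) and is closed under the recursion step.
    Removing from it a pair that is neither (0, a) nor the successor of another pair would
    leave it closed, so every pair has a history ([inv]) and values are unique by induction. *)
Lemma recursion (Y a : M) (F : M -> M -> M) : Fun2 F -> a ∈ Y ->
  (forall n y, is_nat n -> y ∈ Y -> F n y ∈ Y) ->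
  exists s, is_fun s omega Y /\ ap s empty = a /\
    forall n, is_nat n -> ap s (succ n) = F n (ap s n).
Proof.
  intros HF Ha H.
  set (P := prod omega Y).
  set (C := fun Z => pair empty a ∈ Z /\
    forall n y, is_nat n -> y ∈ Y -> pair n y ∈ Z -> pair (succ n) (F n y) ∈ Z).
  assert (HC : Rel1 C) by (unfold C; dfn).
  set (s := sep P (fun p => forall Z, C Z -> p ∈ Z)).
  assert (Hs : forall p, p ∈ s <-> p ∈ P /\ forall Z, C Z -> p ∈ Z)
    by (intros p; unfold s; rewrite in_sep by dfn; tauto).
  assert (Cs : C s).
  { split.
    - apply Hs; split. { apply pair_in_prod; rewrite in_omega; auto using nat_empty. }
      intros Z [K _]; auto.
    - intros n y Hn Hy K; apply Hs in K as [K1 K2]; apply Hs; split.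
      { apply pair_in_prod; rewrite in_omega; auto using nat_succ. }
      intros Z HZ; apply HZ; auto. }
  assert (inv : forall k y, pair k y ∈ s -> (k = empty /\ y = a) \/
     exists n y', is_nat n /\ pair n y' ∈ s /\ k = succ n /\ y = F n y').
  { set (Q := fun p => p = pair empty a \/ exists n y', is_nat n /\ pair n y' ∈ s /\
    p = pair (succ n) (F n y')).
    assert (HQ : Rel1 Q) by (unfold Q; dfn).
    (* minimality of [s] against its subset of pairs with a history *)
    assert (K : C (sep s Q)).
    { split; [|intros n y Hn Hy K]; rewrite in_sep in * by auto.
      - split; [apply Cs|left; auto].
      - split; [apply Cs; tauto|right; exists n, y; tauto]. }
    intros k y Hk. apply Hs in Hk as [_ Hk]. specialize (Hk _ K).
    rewrite in_sep in Hk by auto. destruct Hk as [_ [E|(n & y' & Hn & Hp & E)]];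
    apply pair_inj in E as [-> ->]; [left|right; exists n, y']; auto. }
  assert (uniq : forall n, is_nat n -> exists y, pair n y ∈ s /\ forall z, pair n z ∈ s -> z = y).
  { apply (nat_induction (fun n => exists y, pair n y ∈ s /\ forall z, pair n z ∈ s -> z = y));
    [apply _| |].
    - exists a; split; [apply Cs|]. intros z K; apply inv in K as [[_ K]|(n & y & _ & _ & E & _)];
        auto.
      symmetry in E; apply succ_neq_empty in E; contradiction.
    - intros n Hn (y & Hy & U). exists (F n y); split.
      + apply Cs; auto. apply Hs in Hy as [Hy _]. apply pair_in_prod in Hy; tauto.
      + intros z K; apply inv in K as [[E _]|(n' & y' & Hn' & Hp & E & ->)].
        * apply succ_neq_empty in E; contradiction.
        * apply succ_inj in E; auto; subst. rewrite (U y'); auto. }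
  assert (Fs : is_fun s omega Y).
  { split.
    - intros p Hp; apply Hs in Hp as [Hp _]; apply in_prod in Hp as (x & y & Hx & Hy & E).
      exists x, y; rewrite is_pair_iff; auto.
    - intros n Hn; apply in_omega in Hn. destruct (uniq n Hn) as (y & Hy & U).
      exists y; split; [apply app_iff; auto|]. intros z Hz; symmetry; apply U, app_iff; auto. }
  exists s; split; auto; split.
  - symmetry; apply (fun_app s omega Y); auto. { apply in_omega, nat_empty. } apply app_iff, Cs.
  - intros n Hn; symmetry; apply (fun_app s omega Y); auto. { apply in_omega, nat_succ; auto. }
    apply in_omega in Hn as Hn'.
    apply app_iff, Cs; auto. { eapply fun_in; eauto. } apply app_iff; eapply app_ap; eauto.
Qed.

(** * Finite sets *)

Definition finite a : Prop := exists n, is_nat n /\ equipotent a n.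

#[global] Instance rel_finite : Rel1 finite. Proof. dfn. Qed.

Lemma infinite_iff a : infinite a <-> ~ finite a.
Proof. unfold infinite, finite; firstorder. Qed.

Lemma finite_empty : finite empty.
Proof.
  exists empty; split; [apply nat_empty|].
  apply (equip_intro _ _ (fun x => x)); [dfn|auto|auto|].
  intros x Hx; destruct (in_empty x); auto.
Qed.

Lemma finite_add b x : finite b -> finite (cup b (sing x)).
Proof.
  intros Hb. destruct (classic (x ∈ b)) as [Hx|Hx].
  { assert (cup b (sing x) = b) as ->; auto.
    apply ext; intros z; rewrite in_cup, in_sing; split; auto. intros [| ->]; auto. }
  destruct Hb as (n & Hn & E). exists (succ n); split; auto using nat_succ.
  apply equip_elim in E as (f & Hf & I & S).
  apply (equip_intro _ _ (fun y => ite (y ∈ b) (ap f y) n)); [dfn| | |].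
  - intros y Hy; rewrite in_cup, in_sing in Hy; rewrite in_succ. destruct (classic (y ∈ b)).
    + rewrite ite_true by auto; left; eapply fun_in; eauto.
    + rewrite ite_false; auto.
  - intros y z Hy Hz; rewrite in_cup, in_sing in Hy, Hz.
    destruct (classic (y ∈ b)) as [Yb|Yb], (classic (z ∈ b)) as [Zb|Zb];
    rewrite ?(ite_true (y ∈ b)), ?(ite_true (z ∈ b)), ?(ite_false (y ∈ b)), ?(ite_false (z ∈ b))
      by auto;
    intros K; auto.
    + destruct (mem_irrefl n); rewrite <- K at 1; eapply fun_in; eauto.
    + destruct (mem_irrefl n); rewrite K at 1; eapply fun_in; eauto.
    + destruct Hy, Hz; try contradiction; congruence.
  - intros k Hk; apply in_succ in Hk as [Hk| ->].
    + destruct (S k Hk) as (y & Hy & <-); exists y; rewrite in_cup, ite_true; auto.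
    + exists x; rewrite in_cup, in_sing, ite_false; auto.
Qed.

(** Peeling off the preimage of the last element of n + 1 reduces the size by one. *)
Lemma finite_induction (P : M -> Prop) : Rel1 P -> P empty ->
  (forall b x, P b -> P (cup b (sing x))) -> forall a, finite a -> P a.
Proof.
  intros HP H0 HS a (n & Hn & E); revert n Hn a E.
  apply (nat_induction (fun n => forall a, equipotent a n -> P a)); [apply _| |].
  - intros a E; apply equip_elim in E as (f & Hf & _).
    destruct (empty_or_inhabited a) as [-> |[x Hx]]; auto. destruct (in_empty (ap f x)).
      eapply fun_in; eauto.
  - intros n Hn IH a E; apply equip_elim in E as (f & Hf & I & S).
    destruct (S n) as (x & Hx & Ex). { apply in_succ; auto. }
    set (a' := sep a (fun y => ap f y ∈ n)).
    assert (Ha' : forall y, y ∈ a' <-> y ∈ a /\ ap f y ∈ n)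
      by (intros; unfold a'; rewrite in_sep by apply _; tauto).
    assert (Ea : a = cup a' (sing x)).
    { apply ext; intros y; rewrite in_cup, in_sing, Ha'; split.
      - intros Hy. pose proof (fun_in f a (succ n) y Hf Hy) as K; apply in_succ in K as [K|K]; auto.
        right; apply I; congruence.
      - intros [[? ?]| ->]; auto. }
    rewrite Ea; apply HS, IH. apply (equip_intro _ _ (ap f)); [dfn| | |].
    + intros y Hy; apply Ha' in Hy; tauto.
    + intros y z Hy Hz; apply Ha' in Hy, Hz; apply I; tauto.
    + intros k Hk; destruct (S k) as (y & Hy & <-). { apply in_succ; auto. }
      exists y; rewrite Ha'; auto.
Qed.

Lemma finite_subset a b : finite a -> b ⊆ a -> finite b.
Proof.
  intros Ha; revert b; revert a Ha.
  apply (finite_induction (fun a => forall b, b ⊆ a -> finite b)); [apply _| |].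
  - intros b Hb; assert (b = empty) as ->; [|apply finite_empty].
    apply is_empty_iff; intros x Hx; apply (in_empty x); auto.
  - intros a x IH b Hb.
    set (b' := sep b (fun y => y ∈ a)).
    assert (Hb' : forall y, y ∈ b' <-> y ∈ b /\ y ∈ a) by (intros; unfold b';
      rewrite in_sep by apply _; tauto).
    assert (K : finite b') by (apply IH; intros y Hy; apply Hb' in Hy; tauto).
    destruct (classic (x ∈ b)) as [Hx|Hx].
    + assert (Eb : b = cup b' (sing x)); [|rewrite Eb; auto using finite_add].
      apply ext; intros y; rewrite in_cup, in_sing, Hb'; split.
      * intros Hy; pose proof (Hb y Hy) as L; rewrite in_cup, in_sing in L; tauto.
      * intros [| ->]; tauto.
    + apply IH; intros y Hy. pose proof (Hb y Hy) as L; rewrite in_cup, in_sing in L.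
      destruct L as [| ->]; tauto.
Qed.

Lemma infinite_superset a b : infinite a -> a ⊆ b -> infinite b.
Proof. rewrite !infinite_iff. intros H K L; apply H; eapply finite_subset; eauto. Qed.

End Sets.

(** * Dedekind-infinite sets *)

Section Dedekind.
Context {M : ZF}.

(** In a well-ordered infinite set [D], the elements [W] with finitely many predecessors are
    themselves infinite in number: were [W] finite, the least element outside [W] would have
    only elements of [W] below it. Hence each element of [W] has a successor in [W], and the
    map that sends elements of [W] to their successors and fixes the rest of [A] is injective
    but misses the least element of [W]. Totality of
    [lt] comes from the least-element condition on two-element sets. *)
Lemma dedekind_of_well_order (A D : M) (lt : M -> M -> Prop) : Rel2 lt ->
  D ⊆ A -> infinite D ->
  (forall x y, x ∈ D -> y ∈ D -> lt x y -> ~ lt y x) ->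
  (forall x y z, x ∈ D -> y ∈ D -> z ∈ D -> lt x y -> lt y z -> lt x z) ->
  (forall S, S ⊆ D -> nonempty S -> exists m, m ∈ S /\ forall y, y ∈ S -> y <> m -> lt m y) ->
  dedekind_infinite A.
Proof.
  intros Hlt DA Dinf asym trans least.
  assert (irr : forall x, x ∈ D -> ~ lt x x) by (intros x Hx H; apply (asym x x); auto).
  assert (total : forall x y, x ∈ D -> y ∈ D -> x <> y -> lt x y \/ lt y x).
  { intros x y Hx Hy N. destruct (least (upair x y)) as (m & Hm & L).
    - intros z Hz; apply in_upair in Hz as [-> | ->]; auto.
    - exists x; apply in_upair; auto.
    - apply in_upair in Hm as [-> | ->]; [left|right]; apply L; auto; apply in_upair; auto. }
  set (below := fun x => sep D (fun y => lt y x)).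
  assert (Hbelow : forall x y, y ∈ below x <-> y ∈ D /\ lt y x)
    by (intros; unfold below; rewrite in_sep by dfn; tauto).
  assert (Fbelow : Fun1 below) by (unfold below; dfn).
  set (W := sep D (fun x => finite (below x))).
  assert (HW : forall x, x ∈ W <-> x ∈ D /\ finite (below x))
    by (intros; unfold W; rewrite in_sep by dfn; tauto).
  assert (Winf : infinite W).
  { rewrite infinite_iff in *. intros Wfin.
    destruct (least (sep D (fun x => ~ x ∈ W))) as (m & Hm & L).
    - intros x Hx; rewrite in_sep in Hx by apply _; tauto.
    - apply NNPP; intros K; apply Dinf; apply (finite_subset W); auto.
      intros x Hx; apply NNPP; intros N; apply K; exists x; rewrite in_sep by apply _; auto.
    - rewrite in_sep in Hm by apply _. destruct Hm as [Hm N]. apply N, HW; split; auto.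
      apply (finite_subset W); auto. intros y Hy; apply Hbelow in Hy as [Hy1 Hy2].
      apply NNPP; intros K. apply (asym y m); auto. apply L.
      + rewrite in_sep by apply _; auto.
      + intros ->; apply (irr m); auto. }
  assert (WD : W ⊆ D) by (intros x Hx; apply HW in Hx; tauto).
  set (next := fun x z => z ∈ W /\ lt x z /\ forall y, y ∈ W -> lt x y -> y = z \/ lt z y).
  assert (Hnext : Rel2 next) by (unfold next; dfn).
  set (S := fun x => the (next x)).
  assert (FS : Fun1 S) by (unfold S; dfn).
  assert (HS : forall x, x ∈ W -> next x (S x)).
  { intros x Hx. apply (the_in (next x)).
    - destruct (least (sep W (fun y => lt x y))) as (z & Hz & L).
      + intros y Hy; rewrite in_sep in Hy by dfn; apply WD; tauto.
      + apply NNPP; intros K. rewrite infinite_iff in Winf; apply Winf.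
        apply (finite_subset (cup (below x) (sing x))). { apply finite_add, HW; auto. }
        intros y Hy; rewrite in_cup, in_sing, Hbelow. apply NNPP; intros N.
        apply K; exists y; rewrite in_sep by dfn; split; auto.
        assert (x <> y) by (intros ->; apply N; auto).
        destruct (total x y); auto. destruct N; auto.
      + rewrite in_sep in Hz by dfn. destruct Hz. exists z; split; [|split]; auto.
        intros y Hy Hxy. destruct (classic (y = z)); auto. right; apply L; auto.
        rewrite in_sep by dfn; auto.
    - intros y z (Hy & Hxy & Ly) (Hz & Hxz & Lz).
      destruct (Ly z) as [|K1]; auto. destruct (Lz y) as [|K2]; auto.
      destruct (asym y z); auto. }
  set (F := fun x => ite (x ∈ W) (S x) x).
  assert (FF : Fun1 F) by (unfold F; dfn).
  assert (FW : forall x, x ∈ W -> F x = S x) by (intros; apply ite_true; auto).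
  assert (FN : forall x, ~ x ∈ W -> F x = x) by (intros; apply ite_false; auto).
  assert (FA : forall x, x ∈ A -> F x ∈ A).
  { intros x Hx; destruct (classic (x ∈ W)); [rewrite FW|rewrite FN]; auto.
    apply DA, WD, HS; auto. }
  destruct (least W) as (w & Hw & L); auto.
  { destruct (empty_or_inhabited W) as [E|]; auto. rewrite infinite_iff, E in Winf; destruct Winf;
    apply finite_empty. }
  set (B := sep A (fun y => exists x, x ∈ A /\ F x = y)).
  assert (HB : forall y, y ∈ B <-> y ∈ A /\ exists x, x ∈ A /\ F x = y)
    by (intros; unfold B; rewrite in_sep by dfn; tauto).
  exists B; split; [|split].
  - intros x Hx; apply HB in Hx; tauto.
  - intros E. assert (K : w ∈ B) by (rewrite E; auto).
    apply HB in K as (_ & x & Hx & Ex). destruct (classic (x ∈ W)) as [Wx|Wx].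
    + rewrite FW in Ex by auto. destruct (HS x Wx) as (_ & K & _). rewrite Ex in K.
      apply (asym x w); auto. apply L; auto. intros ->; apply (irr w); auto.
    + rewrite FN in Ex; auto. congruence.
  - apply (equip_intro _ _ F); auto.
    + intros x Hx; apply HB; eauto.
    + intros x y Hx Hy E.
      destruct (classic (x ∈ W)) as [Wx|Wx], (classic (y ∈ W)) as [Wy|Wy];
      rewrite ?(FW x), ?(FW y), ?(FN x), ?(FN y) in E by auto; auto.
      * destruct (HS x Wx) as (K1 & K2 & K3), (HS y Wy) as (L1 & L2 & L3).
        apply NNPP; intros N. destruct (total x y) as [T|T]; auto.
        -- destruct (K3 y) as [K4|K4]; auto.
           ++ apply (irr y); auto. rewrite K4 at 2. rewrite E; auto.
           ++ apply (asym y (S x)); auto. rewrite E; auto.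
        -- destruct (L3 x) as [K4|K4]; auto.
           ++ apply (irr x); auto. rewrite K4 at 2. rewrite <- E; auto.
           ++ apply (asym x (S y)); auto. rewrite <- E; auto.
      * destruct Wy. rewrite <- E. apply HS; auto.
      * destruct Wx. rewrite E. apply HS; auto.
    + intros y Hy; apply HB in Hy; tauto.
Qed.

Definition lex (n k n' k' : M) : Prop := n ∈ n' \/ (n = n' /\ k ∈ k').

#[global] Instance rel_lex : Rel4 lex. Proof. dfn. Qed.

Lemma lex_trans n k n' k' n'' k'' : is_nat n'' -> is_nat k'' ->
  lex n k n' k' -> lex n' k' n'' k'' -> lex n k n'' k''.
Proof.
  intros Hn Hk [H|[-> H]] [K|[-> K]]; unfold lex; auto.
  - left; eapply nat_mem_trans; eauto.
  - right; split; auto; eapply nat_mem_trans; eauto.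
Qed.

Lemma lex_irrefl (n k : M) : ~ lex n k n k.
Proof. intros [H|[_ H]]; apply mem_irrefl in H; auto. Qed.

Lemma lex_total (n k n' k' : M) : is_nat n -> is_nat k -> is_nat n' -> is_nat k' ->
  lex n k n' k' \/ (n = n' /\ k = k') \/ lex n' k' n k.
Proof.
  intros Hn Hk Hn' Hk'; unfold lex.
  destruct (nat_trichotomy n n'), (nat_trichotomy k k'); intuition.
Qed.

Lemma lex_least (Q : M -> M -> Prop) : Rel2 Q -> (exists n k, is_nat n /\ is_nat k /\ Q n k) ->
  exists n k, is_nat n /\ is_nat k /\ Q n k /\
    forall n' k', is_nat n' -> is_nat k' -> Q n' k' -> ~ lex n' k' n k.
Proof.
  intros HQ (n0 & k0 & Hn0 & Hk0 & H).
  destruct (nat_least (fun n => exists k, is_nat k /\ Q n k)) as (n & Hn & H1 & L1); [dfn|eauto|].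
  destruct (nat_least (fun k => Q n k)) as (k & Hk & H2 & L2); [dfn|auto|].
  exists n, k; repeat split; auto. intros n' k' Hn' Hk' K [K1|[-> K1]].
  - apply (L1 n'); eauto.
  - apply (L2 k'); eauto.
Qed.

(** A set covered by a partial map from pairs of naturals is well-ordered by its
    lexicographically least codes. Two indices spare a pairing function on the naturals and
    suit countable families of countable sets. *)
Lemma dedekind_of_enumeration (A D : M) (P : M -> M -> M -> Prop) : Rel3 P ->
  D ⊆ A -> infinite D ->
  (forall n k x y, is_nat n -> is_nat k -> x ∈ D -> y ∈ D -> P n k x -> P n k y -> x = y) ->
  (forall x, x ∈ D -> exists n k, is_nat n /\ is_nat k /\ P n k x) ->
  dedekind_infinite A.
Proof.
  intros HP DA Dinf Pfun Psurj.
  set (lt := fun x y => exists n k, is_nat n /\ is_nat k /\ P n k x /\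
    forall n' k', is_nat n' -> is_nat k' -> P n' k' y -> lex n k n' k').
  assert (Hlt : Rel2 lt) by (unfold lt; dfn).
  apply (dedekind_of_well_order A D lt); auto.
  - intros x y _ _ (n & k & Hn & Hk & Px & Lx) (n' & k' & Hn' & Hk' & Py & Ly).
    apply (lex_irrefl n k). apply (lex_trans n k n' k' n k); auto.
  - intros x y z _ _ _ (n & k & Hn & Hk & Px & Lx) (n' & k' & Hn' & Hk' & Py & Ly).
    exists n, k; split; [|split; [|split]]; auto. intros n'' k'' Hn'' Hk'' Pz.
    apply (lex_trans n k n' k'); auto.
  - intros S SD [x Hx].
    destruct (lex_least (fun n k => exists y, y ∈ S /\ P n k y))
      as (n & k & Hn & Hk & (m & Hm & Pm) & L).
    { dfn. } { destruct (Psurj x) as (n & k & H); auto. exists n, k; intuition eauto. }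
    exists m; split; auto. intros y Hy N. exists n, k; split; [|split; [|split]]; auto.
    intros n' k' Hn' Hk' Py. destruct (lex_total n k n' k') as [K|[[-> ->]|K]]; auto.
    + destruct N; apply (Pfun n' k'); auto.
    + destruct (L n' k'); eauto.
Qed.

(** Iterating a bijection of [A] onto a proper subset from a point outside that subset. *)
Lemma dedekind_sequence (A : M) : dedekind_infinite A -> exists c, is_fun c omega A /\
  forall n m, is_nat n -> is_nat m -> ap c n = ap c m -> n = m.
Proof.
  intros (B & BA & N & E). apply equip_elim in E as (f & Hf & I & _).
  assert (exists a, a ∈ A /\ ~ a ∈ B) as (a & Ha & Na).
  { apply NNPP; intros K; apply N, ext; intros x; split; auto.
    intros Hx; apply NNPP; intros L; apply K; eauto. }
  destruct (recursion A a (fun _ y => ap f y)) as (c & Hc & H0 & HS); [dfn|auto| |].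
  { intros n y _ Hy; apply BA; eapply fun_in; eauto. }
  exists c; split; auto.
  assert (cA : forall n, is_nat n -> ap c n ∈ A) by (intros; eapply fun_in; eauto; apply in_omega;
    auto).
  assert (K : forall n, is_nat n -> ap c empty = ap c (succ n) -> False).
  { intros n Hn E. apply Na. rewrite <- H0, E, HS by auto. eapply fun_in; eauto. }
  intros n m Hn; revert m; revert n Hn.
  (* the first term lies outside [B], and all later terms inside *)
  apply (nat_induction (fun n => forall m, is_nat m -> ap c n = ap c m -> n = m)); [dfn| |].
  - intros m Hm E; destruct (nat_cases m Hm) as [-> |(m' & Hm' & ->)]; auto. destruct (K m'); auto.
  - intros n Hn IH m Hm E; destruct (nat_cases m Hm) as [-> |(m' & Hm' & ->)].
    + destruct (K n); auto.
    + rewrite (IH m'); auto. apply I; auto. rewrite <- !HS; auto.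
Qed.

Definition range (c A : M) : M := sep A (fun x => exists n, is_nat n /\ x = ap c n).

#[global] Instance fun_range : Fun2 range. Proof. dfn. Qed.

Lemma in_range c A x : is_fun c omega A -> x ∈ range c A <-> exists n, is_nat n /\ x = ap c n.
Proof.
  intros H; unfold range; rewrite in_sep by dfn. split; [tauto|].
  intros K; split; auto. destruct K as (n & Hn & ->). eapply fun_in; eauto; apply in_omega; auto.
Qed.

(** A finite set contains the values of an injective sequence at boundedly many indices only. *)
Lemma range_infinite c A : is_fun c omega A ->
  (forall n m, is_nat n -> is_nat m -> ap c n = ap c m -> n = m) -> infinite (range c A).
Proof.
  intros Hc I; rewrite infinite_iff; intros H.
  assert (K : forall b, finite b -> exists n, is_nat n /\ forall m, is_nat m -> ap c m ∈ b ->
    m ∈ n).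
  { apply finite_induction; [dfn| |].
    - exists empty; split; [apply nat_empty|]. intros m _ K; destruct (in_empty (ap c m)); auto.
    - intros b x (n & Hn & Hb). destruct (classic (exists m, is_nat m /\ ap c m = x))
        as [(m & Hm & <-)|N].
      + destruct (nat_max n (succ m)) as (k & Hk & K1 & K2); auto using nat_succ.
        exists k; split; auto. intros l Hl; rewrite in_cup, in_sing; intros [L|L]; auto.
        apply I in L; auto; subst. apply K2, in_succ; auto.
      + exists n; split; auto. intros m Hm; rewrite in_cup, in_sing; intros [L|L]; auto.
        destruct N; eauto. }
  destruct (K _ H) as (n & Hn & L). apply (mem_irrefl n), L; auto. apply in_range; eauto.
Qed.

End Dedekind.

(** * The real numbers of the model *)

Section Reals.
Context {M : ZF} (R : reals M).
Implicit Types (x y z : M).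

Lemma is_fun2_fun (f a b c : M) : is_fun2 f a b c -> is_fun f (prod a b) c.
Proof. intros (p & Hp & H); apply is_prod_iff in Hp as ->; auto. Qed.

Lemma app2_ap (f a b c x y z : M) : is_fun2 f a b c -> x ∈ a -> y ∈ b ->
  (app2 f x y z <-> z = ap f (pair x y)).
Proof.
  intros H Hx Hy; rewrite app2_iff. apply (fun_app f (prod a b) c).
  - apply is_fun2_fun; auto.
  - apply pair_in_prod; auto.
Qed.

Lemma ap_pair_in (f a b c x y : M) : is_fun2 f a b c -> x ∈ a -> y ∈ b -> ap f (pair x y) ∈ c.
Proof.
  intros H Hx Hy; apply (fun_in f (prod a b) c). { apply is_fun2_fun; auto. }
  apply pair_in_prod; auto.
Qed.

Definition add x y : M := ap (radd R) (pair x y).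
Definition mul x y : M := ap (rmul R) (pair x y).

#[global] Instance fun_add : Fun2 add. Proof. dfn. Qed.
#[global] Instance rel_lt : Rel2 (lt_R R). Proof. dfn. Qed.
#[global] Instance rel_le : Rel2 (le_R R). Proof. dfn. Qed.

Lemma add_in x y : x ∈ rset R -> y ∈ rset R -> add x y ∈ rset R.
Proof. apply ap_pair_in, radd_fun. Qed.

Lemma mul_in x y : x ∈ rset R -> y ∈ rset R -> mul x y ∈ rset R.
Proof. apply ap_pair_in, rmul_fun. Qed.

Lemma app2_add x y z : x ∈ rset R -> y ∈ rset R -> (app2 (radd R) x y z <-> z = add x y).
Proof. apply app2_ap with (rset R), radd_fun. Qed.

Lemma app2_mul x y z : x ∈ rset R -> y ∈ rset R -> (app2 (rmul R) x y z <-> z = mul x y).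
Proof. apply app2_ap with (rset R), rmul_fun. Qed.

Hint Resolve add_in mul_in rzero_in rone_in : reals.

Lemma addC x y : x ∈ rset R -> y ∈ rset R -> add x y = add y x.
Proof.
  intros Hx Hy; apply app2_add; auto. apply raddC; auto. apply app2_add; auto.
Qed.

Lemma addA x y z : x ∈ rset R -> y ∈ rset R -> z ∈ rset R -> add x (add y z) = add (add x y) z.
Proof.
  intros Hx Hy Hz; apply app2_add; auto with reals.
  apply (raddA _ R x y z _ (add y z)); auto; apply app2_add; auto with reals.
Qed.

Lemma add0 x : x ∈ rset R -> add x (rzero R) = x.
Proof. intros; symmetry; apply app2_add; auto with reals. apply radd0; auto. Qed.

Lemma neg_ex x : x ∈ rset R -> exists y, y ∈ rset R /\ add x y = rzero R.
Proof.
  intros Hx; destruct (raddN _ R x Hx) as (y & Hy & E). apply app2_add in E; eauto.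
Qed.

Lemma lt_irrefl x : x ∈ rset R -> ~ lt_R R x x.
Proof. apply rlt_irrefl. Qed.

Lemma lt_trans x y z : x ∈ rset R -> y ∈ rset R -> z ∈ rset R ->
  lt_R R x y -> lt_R R y z -> lt_R R x z.
Proof. apply rlt_trans. Qed.

Lemma le_refl x : le_R R x x.
Proof. right; auto. Qed.

Lemma le_trans x y z : x ∈ rset R -> y ∈ rset R -> z ∈ rset R ->
  le_R R x y -> le_R R y z -> le_R R x z.
Proof. intros Hx Hy Hz [H| ->] [K| <-]; [left; apply (rlt_trans _ R x y z)|left|left|right]; auto.
  Qed.

Lemma le_lt_trans x y z : x ∈ rset R -> y ∈ rset R -> z ∈ rset R ->
  le_R R x y -> lt_R R y z -> lt_R R x z.
Proof. intros Hx Hy Hz [H| ->] K; auto. apply (rlt_trans _ R x y z); auto. Qed.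

Lemma lt_le_trans x y z : x ∈ rset R -> y ∈ rset R -> z ∈ rset R ->
  lt_R R x y -> le_R R y z -> lt_R R x z.
Proof. intros Hx Hy Hz H [K| <-]; auto. apply (rlt_trans _ R x y z); auto. Qed.

Lemma le_or_lt x y : x ∈ rset R -> y ∈ rset R -> le_R R x y \/ lt_R R y x.
Proof.
  intros Hx Hy; destruct (rlt_total _ R x y Hx Hy) as [H|[H|H]]; auto; left; [left|right]; auto.
Qed.

Lemma add_lt_r x y z : x ∈ rset R -> y ∈ rset R -> z ∈ rset R ->
  lt_R R x y -> lt_R R (add x z) (add y z).
Proof.
  intros Hx Hy Hz H; apply (rlt_add _ R x y z); auto; apply app2_add; auto.
Qed.

Lemma add_lt x y z w : x ∈ rset R -> y ∈ rset R -> z ∈ rset R -> w ∈ rset R ->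
  lt_R R x y -> lt_R R z w -> lt_R R (add x z) (add y w).
Proof.
  intros Hx Hy Hz Hw H K. apply lt_trans with (add y z); auto with reals.
  - apply add_lt_r; auto.
  - rewrite (addC y z), (addC y w) by auto. apply add_lt_r; auto.
Qed.

Lemma double_inj x y : x ∈ rset R -> y ∈ rset R -> add x x = add y y -> x = y.
Proof.
  intros Hx Hy E. destruct (rlt_total _ R x y Hx Hy) as [H|[H|H]]; auto; exfalso.
  - apply (lt_irrefl (add x x)); auto with reals. rewrite E at 2. apply add_lt; auto.
  - apply (lt_irrefl (add x x)); auto with reals. rewrite E at 1. apply add_lt; auto.
Qed.

(** Multiplication by the inverse of 1 + 1, which is nonzero because doubling is injective. *)
Lemma half_ex x : x ∈ rset R -> exists y, y ∈ rset R /\ add y y = x.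
Proof.
  intros Hx. set (o := rone R). assert (Ho : o ∈ rset R) by apply rone_in.
  assert (N : add o o <> rzero R).
  { intros E. apply (rone_neq_rzero _ R). apply double_inj; auto with reals.
    rewrite add0; auto with reals. }
  destruct (rmulV _ R (add o o)) as (h & Hh & E); auto with reals.
  assert (D : forall a b c, a ∈ rset R -> b ∈ rset R -> c ∈ rset R ->
    mul a (add b c) = add (mul a b) (mul a c)).
  { intros a b c Ha Hb Hc; apply app2_add; auto with reals.
    apply (rmulD _ R a b c (add b c)); auto; try apply app2_add; try apply app2_mul;
      auto with reals. }
  assert (C : forall a b, a ∈ rset R -> b ∈ rset R -> mul a b = mul b a).
  { intros a b Ha Hb; apply app2_mul; auto. apply rmulC; auto. apply app2_mul; auto. }
  assert (I : forall a, a ∈ rset R -> mul a o = a).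
  { intros a Ha; symmetry; apply app2_mul; auto. apply rmul1; auto. }
  apply app2_mul in E; auto with reals.
  exists (mul x h); split; auto with reals.
  rewrite <- D by auto. rewrite <- (I h) by auto. rewrite <- D, (C h), <- E by auto with reals.
  apply I; auto.
Qed.

Lemma half_positive x : x ∈ rset R -> lt_R R (rzero R) (add x x) -> lt_R R (rzero R) x.
Proof.
  intros Hx H. destruct (le_or_lt x (rzero R)) as [[K| ->]|K]; auto with reals; exfalso.
  - apply (lt_irrefl (rzero R)); auto with reals. apply lt_trans with (add x x); auto with reals.
    rewrite <- (add0 (rzero R)); auto with reals. apply add_lt; auto with reals.
  - rewrite add0 in H by auto with reals. apply lt_irrefl in H; auto with reals.
Qed.

Lemma positive_half e : positive R e -> exists y, positive R y /\ add y y = e.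
Proof.
  intros [He P]; destruct (half_ex e He) as (y & Hy & <-).
  exists y; split; auto; split; auto. apply half_positive; auto.
Qed.

#[global] Instance rel_positive : Rel1 (positive R). Proof. dfn. Qed.

(** Repeated halving. A positive lower bound of all the values would make their largest lower
    bound [l] positive, yet 2 l is again a lower bound since each value doubles the next one. *)
Lemma null_sequence : exists E,
  (forall n, is_nat n -> positive R (ap E n)) /\
  (forall n m, is_nat n -> is_nat m -> n ⊆ m -> le_R R (ap E m) (ap E n)) /\
  (forall e, positive R e -> exists n, is_nat n /\ lt_R R (ap E n) e).
Proof.
  set (Pos := sep (rset R) (positive R)).
  assert (HPos : forall x, x ∈ Pos <-> positive R x).
  { intros x; unfold Pos; rewrite in_sep by apply _; split; [tauto|]. intros H; split; auto;
    apply H. }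
  set (half := fun x => the (fun y => y ∈ rset R /\ add y y = x)).
  assert (Hhalf : forall x, positive R x -> positive R (half x) /\ add (half x) (half x) = x).
  { intros x Hx. destruct (positive_half x Hx) as (y & Hy & E).
    assert (half x = y) as ->; auto. apply the_eq; [split; auto; apply Hy|].
    intros z [Hz Ez]; apply double_inj; auto. { apply Hy. } congruence. }
  (* 1 or -1 *)
  assert (exists e, positive R e) as (e & He).
  { destruct (le_or_lt (rone R) (rzero R)) as [[H|H]|H]; auto with reals.
    - destruct (neg_ex (rone R)) as (y & Hy & E); auto with reals.
      exists y; split; auto.
      apply (add_lt_r _ _ y) in H; auto with reals. rewrite E in H.
      rewrite addC, add0 in H by auto with reals; auto.
    - destruct (rone_neq_rzero _ R); auto.
    - exists (rone R); split; auto with reals. }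
  destruct (recursion Pos e (fun _ => half)) as (E & HE & H0 & HS); [dfn|apply HPos; auto| |].
  { intros n y _ Hy; apply HPos; apply Hhalf, HPos; auto. }
  assert (E_pos : forall n, is_nat n -> positive R (ap E n)).
  { intros n Hn; apply HPos; eapply fun_in; eauto; apply in_omega; auto. }
  assert (Edouble : forall n, is_nat n -> add (ap E (succ n)) (ap E (succ n)) = ap E n).
  { intros n Hn; rewrite HS by auto. apply Hhalf; auto. }
  assert (Estep : forall n, is_nat n -> le_R R (ap E (succ n)) (ap E n)).
  { intros n Hn; left. rewrite <- (Edouble n) by auto.
    destruct (E_pos (succ n)) as [K1 K2]; auto using nat_succ.
    rewrite <- (add0 (ap E (succ n))) at 1 by auto.
    rewrite !(addC (ap E (succ n))) by auto with reals. apply add_lt_r; auto with reals. }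
  exists E; split; auto; split.
  - intros n m Hn Hm; revert m Hm. apply (nat_induction
      (fun m => n ⊆ m -> le_R R (ap E m) (ap E n))); [dfn| |].
    + intros H. assert (n = empty) as ->; [|apply le_refl].
      apply is_empty_iff; intros x Hx; apply (in_empty x); auto.
    + intros m Hm IH H. apply nat_le_iff in H; auto using nat_succ. destruct H as [H| ->];
        [|apply le_refl].
      apply le_trans with (ap E m); try apply E_pos; auto using nat_succ. apply IH.
      apply nat_le_iff; auto. apply in_succ; auto.
  - intros x Hx. apply NNPP; intros N.
    set (L := sep (rset R) (fun y => forall n, is_nat n -> le_R R y (ap E n))).
    assert (HL : forall y, y ∈ L <-> y ∈ rset R /\ forall n, is_nat n -> le_R R y (ap E n))
      by (intros; unfold L; rewrite in_sep by dfn; tauto).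
    assert (Lx : x ∈ L).
    { apply HL; split; [apply Hx|]. intros n Hn. destruct (le_or_lt x (ap E n)); auto;
      try apply Hx; try apply E_pos; auto.
      destruct N; eauto. }
    destruct (r_complete _ R L) as (l & [Hl1 Hl2] & Hl3).
    + intros y Hy; apply HL in Hy; tauto.
    + exists x; auto.
    + exists (ap E empty); split. { apply E_pos, nat_empty. } intros y Hy; apply HL in Hy.
        apply Hy, nat_empty.
    (* [l] is the supremum of the lower bounds *)
    + assert (l0 : lt_R R (rzero R) l).
      { apply lt_le_trans with x; auto with reals; try apply Hx. apply Hl2; auto. }
      assert (Ll : add l l ∈ L).
      { apply HL; split; auto with reals. intros n Hn.
        assert (K : le_R R l (ap E (succ n))).
        { apply Hl3; split. { apply E_pos, nat_succ; auto. } intros y Hy; apply HL in Hy.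
          apply Hy, nat_succ; auto. }
        rewrite <- (Edouble n) by auto. destruct K as [K| ->]; [left|right; auto].
        assert (ap E (succ n) ∈ rset R) by (apply E_pos, nat_succ; auto). apply add_lt; auto. }
      apply Hl2 in Ll. apply (lt_irrefl l); auto. apply lt_le_trans with (add l l); auto with reals.
      rewrite <- (add0 l) at 1 by auto. rewrite addC by auto with reals.
      apply add_lt_r; auto with reals.
Qed.

End Reals.

#[global] Hint Resolve add_in mul_in rzero_in rone_in : reals.

(** * Metric spaces *)

Section Metric.
Context {M : ZF} (R : reals M) (X d T : M).
Context (Hd : is_metric R X d) (HT : is_metric_topology R X d T).
Implicit Types (x y z U V : M).

Definition dist x y : M := ap d (pair x y).

#[global] Instance fun_dist : Fun2 dist. Proof. dfn. Qed.

Lemma dist_in x y : x ∈ X -> y ∈ X -> dist x y ∈ rset R.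
Proof. apply ap_pair_in, Hd. Qed.

Lemma app2_dist x y r : x ∈ X -> y ∈ X -> (app2 d x y r <-> r = dist x y).
Proof. apply app2_ap with (rset R), Hd. Qed.

Hint Resolve dist_in : reals.

Lemma dist_ge0 x y : x ∈ X -> y ∈ X -> le_R R (rzero R) (dist x y).
Proof. intros Hx Hy; apply (proj1 (proj2 Hd) x y); auto. apply app2_dist; auto. Qed.

Lemma dist_eq0 x y : x ∈ X -> y ∈ X -> (dist x y = rzero R <-> x = y).
Proof.
  intros Hx Hy. rewrite <- (proj1 (proj2 (proj2 Hd)) x y), app2_dist by auto. split; auto.
Qed.

Lemma dist_sym x y : x ∈ X -> y ∈ X -> dist x y = dist y x.
Proof.
  intros Hx Hy. apply app2_dist; auto. apply (proj1 (proj2 (proj2 (proj2 Hd)))); auto.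
    apply app2_dist; auto.
Qed.

Lemma dist_triangle x y z : x ∈ X -> y ∈ X -> z ∈ X ->
  le_R R (dist x z) (add R (dist x y) (dist y z)).
Proof.
  intros Hx Hy Hz. apply (proj2 (proj2 (proj2 (proj2 Hd))) x y z (dist x y) (dist y z)); auto;
  try apply app2_dist; try apply app2_add; auto with reals.
Qed.

Lemma dist_lt_add x y z e e' : x ∈ X -> y ∈ X -> z ∈ X -> e ∈ rset R -> e' ∈ rset R ->
  lt_R R (dist x y) e -> lt_R R (dist y z) e' -> lt_R R (dist x z) (add R e e').
Proof.
  intros. apply le_lt_trans with (add R (dist x y) (dist y z)); auto with reals.
  - apply dist_triangle; auto.
  - apply add_lt; auto with reals.
Qed.

Lemma open_iff U : U ∈ T <-> U ⊆ X /\ forall x, x ∈ U -> exists e, positive R e /\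
  forall y, y ∈ X -> lt_R R (dist x y) e -> y ∈ U.
Proof.
  rewrite (HT U). split; intros [H1 H2]; split; auto; intros x Hx;
    destruct (H2 x Hx) as (e & He & K);
  exists e; split; auto.
  - intros y Hy L; apply (K y (dist x y)); auto. apply app2_dist; auto.
  - intros y r Hy E L; apply app2_dist in E; auto. subst; auto.
Qed.

Lemma dist_positive x y : x ∈ X -> y ∈ X -> x <> y -> positive R (dist x y).
Proof.
  intros Hx Hy N; split; auto with reals. destruct (dist_ge0 x y) as [H|H]; auto.
  destruct N; apply dist_eq0; auto.
Qed.

Lemma punctured_open x : x ∈ X -> sep X (fun y => y <> x) ∈ T.
Proof.
  intros Hx; apply open_iff; split.
  - intros y Hy; rewrite in_sep in Hy by dfn; tauto.
  - intros y Hy; rewrite in_sep in Hy by dfn. destruct Hy as [Hy N].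
    exists (dist y x); split. { apply dist_positive; auto. }
    intros z Hz L; rewrite in_sep by dfn; split; auto. intros ->.
    apply lt_irrefl in L; auto with reals.
Qed.

Definition ball x e : M := sep X (fun y => lt_R R (dist x y) e).

Lemma in_ball x e y : y ∈ ball x e <-> y ∈ X /\ lt_R R (dist x y) e.
Proof. unfold ball; rewrite in_sep by dfn; tauto. Qed.

Lemma ball_center x e : x ∈ X -> positive R e -> x ∈ ball x e.
Proof.
  intros Hx He; apply in_ball; split; auto. assert (dist x x = rzero R) as -> by (apply dist_eq0;
    auto).
  apply He.
Qed.

Lemma ball_open x e : x ∈ X -> e ∈ rset R -> ball x e ∈ T.
Proof.
  intros Hx He; apply open_iff; split.
  - intros y Hy; apply in_ball in Hy; tauto.
  - intros y Hy; apply in_ball in Hy as [Hy L].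
    destruct (neg_ex R (dist x y)) as (n & Hn & En); auto with reals.
    (* the radius e - d(x, y) *)
    exists (add R e n); split.
    + split; auto with reals. rewrite <- En. apply add_lt_r; auto with reals.
    + intros z Hz K; apply in_ball; split; auto.
      apply le_lt_trans with (add R (dist x y) (dist y z)); auto with reals.
      * apply dist_triangle; auto.
      * assert (E : add R (dist x y) (add R e n) = e).
        { rewrite (addC R e n), addA, En, addC, add0; auto with reals. }
        rewrite <- E at 1. rewrite !(addC R (dist x y)) by auto with reals.
        apply add_lt_r; auto with reals.
Qed.

Definition closure V : M := sep X (fun x => forall U, U ∈ T -> x ∈ U -> exists z, z ∈ V /\ z ∈ U).

#[global] Instance fun_closure : Fun1 closure. Proof. dfn. Qed.

Lemma in_closure V x : x ∈ closure V <-> x ∈ X /\ forall U, U ∈ T -> x ∈ U -> exists z, z ∈ V /\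
  z ∈ U.
Proof. unfold closure; rewrite in_sep by dfn; tauto. Qed.

(** A bound on distances instead of a diameter, which avoids the supremum until
    completeness is invoked. *)
Definition small e V : Prop := forall y z, y ∈ V -> z ∈ V -> le_R R (dist y z) e.

#[global] Instance rel_small : Rel2 small. Proof. dfn. Qed.

(** Regularity and arbitrarily small base sets at once: a ball of radius e4 with 4 e4 below
    both [e] and the radius of a ball inside [W] has its closure in the ball of radius 2 e4. *)
Lemma small_nbhd B W x e : is_base T B -> W ∈ T -> x ∈ W -> positive R e ->
  exists V, V ∈ B /\ x ∈ V /\ closure V ⊆ W /\ small e (closure V).
Proof.
  intros [HB1 HB2] HW Hx He.
  destruct (proj1 (open_iff W) HW) as [WX HWx]. destruct (HWx x Hx) as (e1 & He1 & K).
  assert (xX : x ∈ X) by auto.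
  assert (exists e2, positive R e2 /\ le_R R e2 e /\ le_R R e2 e1) as (e2 & He2 & L1 & L2).
  { destruct (le_or_lt R e e1); try apply He; try apply He1.
    - exists e; split; auto; split; auto. apply le_refl.
    - exists e1; split; auto; split; [left; auto|apply le_refl]. }
  destruct (positive_half R e2 He2) as (e3 & He3 & E3).
  destruct (positive_half R e3 He3) as (e4 & He4 & E4).
  destruct (HB2 (ball x e4) x) as (V & HV & Vx & VB).
    { apply ball_open; auto; apply He4. } { apply ball_center; auto. }
  exists V; split; auto; split; auto.
  assert (C : forall y, y ∈ closure V -> y ∈ X /\ lt_R R (dist x y) e3).
  { intros y Hy; apply in_closure in Hy as [Hy Hc]; split; auto.
    destruct (Hc (ball y e4)) as (z & Hz & Hzy).
      { apply ball_open; auto; apply He4. } { apply ball_center; auto. }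
    apply VB, in_ball in Hz as [Hz Hz']. apply in_ball in Hzy as [_ Hzy].
    rewrite <- E4. apply dist_lt_add with z; auto; try apply He4. rewrite dist_sym; auto. }
  destruct He1 as [He1 _], He2 as [He2 _], He3 as [He3 P3], He as [He _]. split.
  - intros y Hy; apply C in Hy as [Hy L]; apply K; auto.
    apply lt_le_trans with e2; auto with reals. apply lt_trans with e3; auto with reals.
    rewrite <- E3. rewrite <- (add0 R e3) at 1 by auto. rewrite addC by auto with reals.
      apply add_lt_r; auto with reals.
  - intros y z Hy Hz; apply C in Hy as [Hy Ly]; apply C in Hz as [Hz Lz].
    apply le_trans with e2; auto with reals. left. rewrite <- E3.
    apply dist_lt_add with x; auto. rewrite dist_sym; auto.
Qed.

Lemma small_diameter e A : e ∈ rset R -> A ⊆ X -> nonempty A -> small e A ->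
  exists r, r ∈ rset R /\ is_diameter R d A r /\ le_R R r e.
Proof.
  intros He AX [a Ha] S.
  set (D := sep (rset R) (fun t => exists x y, x ∈ A /\ y ∈ A /\ app2 d x y t)).
  assert (HD : forall t, t ∈ D <-> exists x y, x ∈ A /\ y ∈ A /\ app2 d x y t).
  { intros t; unfold D; rewrite in_sep by dfn; split; [tauto|].
    intros (x & y & Hx & Hy & E); split; eauto. apply app2_dist in E; auto. subst;
      auto with reals. }
  assert (Ub : upper_bound (rset R) (rlt R) D e).
  { split; auto. intros t Ht; apply HD in Ht as (x & y & Hx & Hy & E).
    apply app2_dist in E; auto. subst. apply S; auto. }
  destruct (r_complete _ R D) as (r & Hr).
  - intros t Ht; unfold D in Ht; rewrite in_sep in Ht by dfn; tauto.
  - exists (dist a a); apply HD; exists a, a; rewrite app2_dist; auto.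
  - eauto.
  - exists r; split; [apply Hr|split; [exists D; auto|apply Hr; auto]].
Qed.

Lemma small_null_unique E A x y :
  (forall n, is_nat n -> positive R (ap E n)) ->
  (forall e, positive R e -> exists n, is_nat n /\ lt_R R (ap E n) e) ->
  A ⊆ X -> (forall n, is_nat n -> small (ap E n) A) -> x ∈ A -> y ∈ A -> x = y.
Proof.
  intros E_pos E_null AX H Hx Hy. apply NNPP; intros N.
  destruct (E_null (dist x y)) as (n & Hn & L). { apply dist_positive; auto. }
  apply (lt_irrefl R (dist x y)); auto with reals.
  apply le_lt_trans with (ap E n); auto with reals. { apply E_pos; auto. } apply H; auto.
Qed.

End Metric.

(** * Second-countable spaces *)

Section Topology.
Context {M : ZF} (X T : M) (hT : is_topology X T).
Implicit Types (x y z U V W A : M).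

Lemma open_sub U : U ∈ T -> U ⊆ X.
Proof. apply hT. Qed.

Definition inter U V : M := sep U (fun x => x ∈ V).

Lemma in_inter U V x : x ∈ inter U V <-> x ∈ U /\ x ∈ V.
Proof. unfold inter; rewrite in_sep by dfn; tauto. Qed.

#[global] Instance fun_inter : Fun2 inter. Proof. dfn. Qed.

Lemma inter_open U V : U ∈ T -> V ∈ T -> inter U V ∈ T.
Proof.
  intros HU HV; destruct hT as (_ & _ & _ & _ & H). apply (H U V); auto. apply in_inter.
Qed.

Lemma open_local U : U ⊆ X -> (forall x, x ∈ U -> exists W, W ∈ T /\ x ∈ W /\ W ⊆ U) -> U ∈ T.
Proof.
  intros UX H. destruct hT as (_ & _ & _ & K & _). apply (K (sep T (fun W => W ⊆ U))).
  - intros W HW; rewrite in_sep in HW by dfn; tauto.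
  - intros x; split.
    + intros Hx; destruct (H x Hx) as (W & HW & Wx & WU). exists W; rewrite in_sep by dfn; auto.
    + intros (W & HW & Wx); rewrite in_sep in HW by dfn; apply HW; auto.
Qed.

Lemma closed_local A : A ⊆ X ->
  (forall x, x ∈ X -> ~ x ∈ A -> exists W, W ∈ T /\ x ∈ W /\ forall y, y ∈ W -> ~ y ∈ A) ->
  closed X T A.
Proof.
  intros AX H; split; auto. exists (sep X (fun x => ~ x ∈ A)).
  assert (K : forall x, x ∈ sep X (fun x => ~ x ∈ A) <-> x ∈ X /\ ~ x ∈ A) by (intros;
    rewrite in_sep by dfn; tauto).
  split; auto. apply open_local.
  - intros x Hx; apply K in Hx; tauto.
  - intros x Hx; apply K in Hx as [Hx N]. destruct (H x Hx N) as (W & HW & Wx & L).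
    exists W; split; auto; split; auto. intros y Hy; apply K; split; auto. apply (open_sub W); auto.
Qed.

Lemma closed_sep A x : closed X T A -> x ∈ X -> ~ x ∈ A ->
  exists W, W ∈ T /\ x ∈ W /\ forall y, y ∈ W -> ~ y ∈ A.
Proof.
  intros (_ & U & HU & K) Hx N. exists U; split; auto; split.
  - apply K; auto.
  - intros y Hy; apply K in Hy; tauto.
Qed.

Lemma sub_closure V : V ∈ T -> V ⊆ closure X T V.
Proof. intros HV x Hx; apply in_closure; split; eauto. apply (open_sub V); auto. Qed.

Lemma closure_closed V : closed X T (closure X T V).
Proof.
  apply closed_local. { intros x Hx; apply in_closure in Hx; tauto. }
  intros x Hx N. apply NNPP; intros K. apply N, in_closure; split; auto.
  intros U HU Ux. apply NNPP; intros L. apply K; exists U; split; auto; split; auto.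
  intros y Hy C; apply in_closure in C as [_ C]. destruct (C U HU Hy); eauto.
Qed.

Lemma not_in_closure V x : x ∈ X -> ~ x ∈ closure X T V ->
  exists W, W ∈ T /\ x ∈ W /\ forall y, y ∈ W -> ~ y ∈ V.
Proof.
  intros Hx N. apply NNPP; intros K. apply N, in_closure; split; auto.
  intros U HU Ux. apply NNPP; intros L. apply K; exists U; split; auto; split; auto.
  intros y Hy C; eauto.
Qed.

Lemma Gdelta_intro A (U : M -> M) : Fun1 U -> (forall n, is_nat n -> U n ∈ T) ->
  (forall x, x ∈ A <-> x ∈ X /\ forall n, is_nat n -> x ∈ U n) -> is_Gdelta X T A.
Proof.
  intros HU HO H.
  assert (K : forall n, n ∈ omega -> U n ∈ T) by (intros n Hn; apply HO, in_omega; auto).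
  pose proof (lam_fun _ _ U HU K) as L. exists (lam omega T U). split. { apply is_seq_iff; auto. }
  intros x; rewrite H; split; intros [Hx Hn]; split; auto.
  - intros n V Hnat Ha. apply in_omega in Hnat as Hn'.
    apply (fun_app _ _ _ _ _ L) in Ha; auto. rewrite lam_ap in Ha; auto; subst; auto.
  - intros n Hnat. apply in_omega in Hnat as Hn'. apply (Hn n); auto.
    rewrite <- (lam_ap omega T U) by auto. eapply app_ap; eauto.
Qed.

Lemma converges_iff s A x : is_fun s omega A -> (converges T s x <-> forall U, U ∈ T -> x ∈ U ->
    exists n, is_nat n /\ forall m, is_nat m -> n ⊆ m -> ap s m ∈ U).
Proof.
  intros Hs; split; intros H U HU Ux; destruct (H U HU Ux) as (n & Hn & K); exists n; split; auto.
  - intros m Hm L; apply (K m); auto. eapply app_ap; eauto. apply in_omega; auto.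
  - intros m y Hm L Hy; apply (fun_app s omega A) in Hy; auto; subst; auto. apply in_omega; auto.
Qed.

Section T1.
Context (T1 : forall x, x ∈ X -> sep X (fun y => y <> x) ∈ T).

Lemma in_punctured x y : y ∈ sep X (fun y => y <> x) <-> y ∈ X /\ y <> x.
Proof. rewrite in_sep by dfn; tauto. Qed.

(** In a T1 space finite sets are closed; the formulation lets [x] lie in [b]. *)
Lemma avoid_finite x b : x ∈ X -> finite b ->
  exists U, U ∈ T /\ x ∈ U /\ forall y, y ∈ b -> y ∈ U -> y = x.
Proof.
  intros Hx; revert b. apply finite_induction; [dfn| |].
  - exists X; split; [apply hT|split; auto]. intros y Hy; destruct (in_empty y); auto.
  - intros b z (U & HU & Ux & K). destruct (classic (z ∈ X /\ z <> x)) as [[Hz N]|N].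
    + exists (inter U (sep X (fun y => y <> z))); split; [|split].
      * apply inter_open; auto.
      * apply in_inter; rewrite in_punctured; auto.
      * intros y Hy; rewrite in_inter, in_punctured; rewrite in_cup, in_sing in Hy. intuition.
    + exists U; split; auto; split; auto. intros y Hy Uy; rewrite in_cup, in_sing in Hy.
      destruct Hy as [Hy| ->]; auto. apply NNPP; intros L; apply N; split; auto.
        apply (open_sub U); auto.
Qed.

Lemma sing_closed x : x ∈ X -> closed X T (sing x).
Proof.
  intros Hx; apply closed_local. { intros y Hy; apply in_sing in Hy as ->; auto. }
  intros y Hy N; rewrite in_sing in N. exists (sep X (fun y => y <> x)); split; auto.
  rewrite in_punctured; split; auto. intros z; rewrite in_punctured, in_sing; tauto.
Qed.

(** A countable union of closed singletons, the countability being witnessed by [c]. *)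
Lemma range_Fsigma c A : is_fun c omega A -> A ⊆ X -> is_Fsigma X T (range c A).
Proof.
  intros Hc AX.
  set (K := sep (pow X) (closed X T)). set (F := lam omega K (fun n => sing (ap c n))).
  assert (HK : forall C, C ∈ K -> closed X T C) by (intros C HC; unfold K in HC;
    rewrite in_sep in HC by dfn; tauto).
  assert (FK : forall n, n ∈ omega -> sing (ap c n) ∈ K).
  { intros n Hn. assert (ap c n ∈ X) by (apply AX; eapply fun_in; eauto).
    unfold K; rewrite in_sep by dfn; split; [|apply sing_closed; auto].
    apply in_pow; intros y Hy; apply in_sing in Hy as ->; auto. }
  assert (HF : is_fun F omega K) by (apply lam_fun; auto; dfn).
  exists K, F; split; auto; split. { apply is_seq_iff; auto. }
  intros x; rewrite in_range by auto; split.
  - intros (n & Hn & ->). apply in_omega in Hn as Hn'. exists n, (ap F n); split; auto; split.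
    + eapply app_ap; eauto.
    + unfold F; rewrite lam_ap; auto; [apply in_sing; auto|dfn].
  - intros (n & C & Hn & Ha & HC). apply in_omega in Hn as Hn'. exists n; split; auto.
    apply (fun_app _ _ _ _ _ HF) in Ha; auto. unfold F in Ha; rewrite lam_ap in Ha; auto; [|dfn].
    subst; apply in_sing; auto.
Qed.

(** A finite range would leave a neighborhood of [x] without terms of the sequence. *)
Lemma convergent_range_infinite s A x : is_fun s omega A -> x ∈ X -> converges T s x ->
  (forall n, is_nat n -> ap s n <> x) -> infinite (range s A).
Proof.
  intros Hs Hx Hc N; rewrite infinite_iff; intros H.
  destruct (avoid_finite x _ Hx H) as (U & HU & Ux & K).
  destruct (proj1 (converges_iff s A x Hs) Hc U HU Ux) as (n & Hn & L).
  apply (N n); auto. apply K. { apply in_range; eauto. } apply L; auto. intros z; auto.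
Qed.

(** A point [y] other than [x] is separated from a neighborhood of [x] that contains all but
    finitely many terms; the remaining terms are removed one by one. *)
Lemma convergent_range_closed s A x :
  (forall y, y ∈ X -> y <> x -> exists V, V ∈ T /\ x ∈ V /\ ~ y ∈ closure X T V) ->
  is_fun s omega A -> A ⊆ X -> x ∈ X ->
  converges T s x -> closed X T (cup (range s A) (sing x)).
Proof.
  intros T2 Hs AX Hx Hc.
  assert (HR : forall z, z ∈ cup (range s A) (sing x) <-> (exists n, is_nat n /\ z = ap s n) \/
    z = x)
    by (intros; rewrite in_cup, in_sing, in_range; tauto).
  assert (sX : forall n, is_nat n -> ap s n ∈ X) by (intros; apply AX; eapply fun_in; eauto;
    apply in_omega; auto).
  apply closed_local.
  { intros z Hz; apply HR in Hz as [(n & Hn & ->)| ->]; auto. }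
  intros y Hy N; rewrite HR in N.
  destruct (T2 y) as (V & HV & Vx & L); auto.
  destruct (not_in_closure V y) as (U & HU & Uy & D); auto.
  destruct (proj1 (converges_iff s A x Hs) Hc V HV Vx) as (n & Hn & K).
  assert (exists W, W ∈ T /\ y ∈ W /\ forall m, m ∈ n -> ~ ap s m ∈ W) as (W & HW & Wy & LW).
  { clear K; revert n Hn. apply (nat_induction (fun n => exists W, W ∈ T /\ y ∈ W /\ forall m,
    m ∈ n -> ~ ap s m ∈ W)); [dfn| |].
    - exists X; split; [apply hT|split; auto]. intros m Hm; destruct (in_empty m); auto.
    - intros n Hn (W & HW & Wy & K). exists (inter W (sep X (fun y => y <> ap s n))); split;
        [|split].
      + apply inter_open; auto.
      + apply in_inter; rewrite in_punctured; split; auto; split; auto. intros ->; apply N; eauto.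
      + intros m Hm; rewrite in_inter, in_punctured. apply in_succ in Hm as [Hm| ->]; [|tauto].
        intros [K1 _]; apply (K m); auto. }
  exists (inter W U); split; [apply inter_open; auto|]. split; [apply in_inter; auto|].
  intros z Hz; apply in_inter in Hz as [Wz Uz]. rewrite HR; intros [(m & Hm & ->)| ->].
  - destruct (nat_le_total n m) as [K1|K1]; auto.
    + apply (D (ap s m)); auto.
    + apply (LW m); auto.
  - apply (D x); auto.
Qed.

End T1.

Section Base.
Context (B f : M) (HB : is_base T B) (Hf : forall V, V ∈ B -> is_nat (ap f V))
  (If : forall V W, V ∈ B -> W ∈ B -> ap f V = ap f W -> V = W).

Lemma base_open V : V ∈ B -> V ∈ T.
Proof. apply HB. Qed.

(** Finitely many base sets have index below [n], by injectivity of the indexing. *)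
Lemma initial_nbhd x n : x ∈ X -> is_nat n ->
  exists U, U ∈ T /\ x ∈ U /\ forall V, V ∈ B -> ap f V ∈ n -> x ∈ V -> U ⊆ V.
Proof.
  intros Hx; revert n. apply (nat_induction (fun n =>
   exists U, U ∈ T /\ x ∈ U /\ forall V, V ∈ B -> ap f V ∈ n -> x ∈ V -> U ⊆ V)); [dfn| |].
  - exists X; split; [apply hT|split; auto]. intros V _ H; apply in_empty in H; contradiction.
  - intros n Hn (U & HU & Ux & K).
    destruct (classic (exists V, V ∈ B /\ ap f V = n /\ x ∈ V)) as [(V & HV & E & Vx)|N].
    + exists (inter U V); split; [|split].
      * apply inter_open; auto using base_open.
      * apply in_inter; auto.
      * intros V' HV' L Vx' z Hz; apply in_inter in Hz as [Hz1 Hz2].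
        apply in_succ in L as [L|L].
        -- apply (K V'); auto.
        -- rewrite (If V' V); auto. congruence.
    + exists U; split; auto; split; auto. intros V' HV' L Vx'.
      apply in_succ in L as [L|L]; auto. destruct N; eauto.
Qed.

(** Countability of the range of [c] replaces choice: the n-th term is the value of [c] of
    least index that differs from [x] and lies in every base set around [x] of index below n. *)
Lemma sequence_to_accumulation_point c A x : is_fun c omega A -> x ∈ X ->
  (forall U, U ∈ T -> x ∈ U -> exists m, is_nat m /\ ap c m ∈ U /\ ap c m <> x) ->
  exists s, is_fun s omega A /\ converges T s x /\ forall n, is_nat n -> ap s n <> x.
Proof.
  intros Hc Hx H.
  set (good := fun n m => is_nat m /\ ap c m <> x /\ forall V, V ∈ B -> ap f V ∈ n -> x ∈ V ->
    ap c m ∈ V).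
  assert (Hgood : Rel2 good) by (unfold good; dfn).
  set (sel := fun n => the (fun m => good n m /\ forall k, good n k -> ~ k ∈ m)).
  assert (Hsel : Fun1 sel) by (unfold sel; dfn).
  assert (S : forall n, is_nat n -> good n (sel n)).
  { intros n Hn. apply (the_in (fun m => good n m /\ forall k, good n k -> ~ k ∈ m)).
    - destruct (initial_nbhd x n) as (U & HU & Ux & K); auto.
      destruct (H U HU Ux) as (m & Hm & Um & Nm).
      destruct (nat_least (fun m => good n m)) as (k & Hk & Gk & L).
      + dfn.
      + exists m; split; auto; split; auto; split; auto. intros V HV HVn Vx. apply (K V); auto.
      + exists k; split; auto. intros l Hl; apply L; auto. apply Hl.
    - intros k l [Gk Lk] [Gl Ll]. destruct (nat_trichotomy k l) as [K|[K|K]]; auto; try apply Gk;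
        try apply Gl.
      + destruct (Ll k); auto.
      + destruct (Lk l); auto. }
  assert (FA : forall n, n ∈ omega -> ap c (sel n) ∈ A).
  { intros n Hn; apply in_omega in Hn. eapply fun_in; eauto. apply in_omega, (S n Hn). }
  set (s := lam omega A (fun n => ap c (sel n))).
  assert (Hs : is_fun s omega A) by (apply lam_fun; auto; dfn).
  assert (Es : forall n, is_nat n -> ap s n = ap c (sel n)).
  { intros n Hn. unfold s. rewrite lam_ap; auto; [dfn|apply in_omega; auto]. }
  exists s; split; auto; split.
  - apply (converges_iff s A x); auto. intros U HU Ux.
    destruct (proj2 HB U x HU Ux) as (V & HV & Vx & VU).
    exists (succ (ap f V)); split; auto using nat_succ. intros m Hm L.
    rewrite Es by auto. apply VU, S; auto. apply L, in_succ; auto.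
  - intros n Hn; rewrite Es by auto. apply S; auto.
Qed.

End Base.
End Topology.

(** * Canonical points in Cantor complete spaces *)

Section Complete.
Context {M : ZF} (R : reals M) (X T d : M) (hT : is_topology X T)
  (Hd : is_metric R X d) (HT : is_metric_topology R X d T) (HC : cantor_complete R X d)
  (B f : M) (HB : is_base T B) (Hf : forall V, V ∈ B -> is_nat (ap f V))
  (If : forall V W, V ∈ B -> W ∈ B -> ap f V = ap f W -> V = W)
  (E : M) (E_pos : forall n, is_nat n -> positive R (ap E n))
  (E_mono : forall n m, is_nat n -> is_nat m -> n ⊆ m -> le_R R (ap E m) (ap E n))
  (E_null : forall e, positive R e -> exists n, is_nat n /\ lt_R R (ap E n) e).
Implicit Types (x y z V W A : M).
#[local] Notation closure := (closure X T).
#[local] Notation small := (small R d).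

Lemma base_least (P : M -> Prop) : Rel1 P -> (exists V, V ∈ B /\ P V) ->
  exists V, V ∈ B /\ P V /\ forall W, W ∈ B -> P W -> ~ ap f W ∈ ap f V.
Proof.
  intros HP (V & HV & PV).
  destruct (nat_least (fun n => exists V, V ∈ B /\ P V /\ ap f V = n))
    as (n & Hn & (W & HW & PW & <-) & L).
  - dfn.
  - exists (ap f V); split; auto. exists V; auto.
  - exists W; split; auto; split; auto. intros W' HW' PW'; apply L; eauto.
Qed.

(** Cantor completeness applied to the closures of the [s n], whose diameters are at most
    the terms of the null sequence, from the second set on. *)
Lemma nested_intersection s : is_fun s omega B ->
  (forall n, is_nat n -> nonempty (ap s n)) ->
  (forall n, is_nat n -> closure (ap s (succ n)) ⊆ ap s n) ->
  (forall n, is_nat n -> small (ap E n) (closure (ap s (succ n)))) ->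
  exists p, p ∈ X /\ forall n, is_nat n -> p ∈ ap s n.
Proof.
  intros Hs Ne Dec Sm.
  assert (sT : forall n, is_nat n -> ap s n ∈ T).
  { intros n Hn; apply HB. eapply fun_in; eauto; apply in_omega; auto. }
  set (K := sep (pow X) (fun A => closed X T A /\ nonempty A)).
  assert (HK : forall A, A ∈ K <-> closed X T A /\ nonempty A).
  { intros A; unfold K; rewrite in_sep by dfn. split; [tauto|]. intros H; split; auto.
    apply in_pow, H. }
  assert (Ne' : forall n, is_nat n -> nonempty (closure (ap s n))).
  { intros n Hn; destruct (Ne n Hn) as [x Hx]; exists x. apply (sub_closure X T hT); auto. }
  assert (FK : forall n, n ∈ omega -> closure (ap s n) ∈ K).
  { intros n Hn; apply in_omega in Hn. apply HK; split; auto. apply closure_closed; auto. }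
  set (F := lam omega K (fun n => closure (ap s n))).
  assert (HF : is_fun F omega K) by (apply lam_fun; auto; dfn).
  assert (EF : forall n, is_nat n -> forall A, app F n A <-> A = closure (ap s n)).
  { intros n Hn A. apply in_omega in Hn. rewrite (fun_app F omega K) by auto.
    unfold F. rewrite lam_ap; auto; [tauto|dfn]. }
  destruct (HC T HT K F) as (p & Hp & L).
  - intros A HA; apply HK; auto.
  - apply is_seq_iff; auto.
  - intros n m A A' Hn Hm HA HA'. apply is_succ_iff in Hm as ->.
    apply EF in HA; auto. apply EF in HA'; auto using nat_succ. subst.
    intros x Hx. apply (sub_closure X T hT); auto. apply Dec; auto.
  - intros e He. destruct (E_null e He) as (n & Hn & L). exists (succ n); split;
      auto using nat_succ.
    intros m A Hm Hnm HA. apply EF in HA; auto; subst A.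
    (* only the sets from index n + 1 on are known to be small *)
    assert (K1 : n ∈ m) by (apply Hnm, in_succ; auto).
    destruct (nat_cases m Hm) as [-> |(k & Hk & ->)]. { destruct (in_empty n); auto. }
    assert (K2 : n ⊆ k) by (apply nat_le_iff; auto; apply in_succ; auto).
    destruct (small_diameter R X d Hd (ap E k) (closure (ap s (succ k)))) as (r & Hr & D & Lr);
      auto.
    + apply E_pos; auto.
    + intros x Hx; apply in_closure in Hx; tauto.
    + exists r; split; auto. apply le_lt_trans with (ap E k); auto; try apply E_pos; auto;
        try apply He.
      apply le_lt_trans with (ap E n); auto; try apply E_pos; auto; apply He.
  - exists p; split; auto. intros n Hn. apply Dec; auto.
    apply (L (succ n)); auto using nat_succ. apply EF; auto using nat_succ.
Qed.

Section Pick.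
Context (U : M -> M -> M) (FU : Fun2 U) (OU : forall i n, is_nat i -> is_nat n -> U i n ∈ T).

(** [U i] presents a G-delta set for each index [i]; the index ranges over the closed pieces
    when an F-sigma set is treated. *)
Definition core i : M := sep X (fun x => forall n, is_nat n -> x ∈ U i n).
#[local] Instance fun_core : Fun1 core. Proof. dfn. Qed.

Lemma in_core i x : x ∈ core i <-> x ∈ X /\ forall n, is_nat n -> x ∈ U i n.
Proof. unfold core; rewrite in_sep by dfn; tauto. Qed.

Definition meets i V : Prop := V ∈ B /\ exists x, x ∈ V /\ x ∈ core i.
#[local] Instance rel_meets : Rel2 meets. Proof. dfn. Qed.

(** An admissible next set in the nested sequence: it shrinks into the n-th open set while
    still meeting the G-delta set. *)
Definition candidate i n V W : Prop :=
  meets i W /\ closure W ⊆ V /\ closure W ⊆ U i n /\ small (ap E n) (closure W).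
#[local] Instance rel_candidate : Rel4 candidate. Proof. dfn. Qed.

Definition next i n V : M :=
  the (fun W => candidate i n V W /\ forall W', candidate i n V W' -> ~ ap f W' ∈ ap f W).
#[local] Instance fun_next : Fun3 next. Proof. dfn. Qed.

Lemma next_candidate i n V : is_nat i -> is_nat n -> meets i V -> candidate i n V (next i n V).
Proof.
  intros Hi Hn [HV (x & Vx & Px)].
  apply (the_in (fun W => candidate i n V W /\ forall W', candidate i n V W' ->
    ~ ap f W' ∈ ap f W)).
  - assert (VT : V ∈ T) by (apply HB; auto).
    destruct (small_nbhd R X d T Hd HT B (inter V (U i n)) x (ap E n)) as (W & HW & Wx & CW & SW);
      auto.
    + apply (inter_open X T hT); auto.
    + apply in_inter; split; auto. apply in_core in Px. apply Px; auto.
    + destruct (base_least (fun W => candidate i n V W)) as (W' & HW' & CW' & L).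
      * dfn.
      * exists W; split; auto; split; [split; eauto|split; [|split]]; auto;
        intros y Hy; apply CW, in_inter in Hy; tauto.
      * exists W'; split; auto. intros W'' CW''; apply L; auto. apply CW''.
  - intros W W' [C L] [C' L']. assert (HW : W ∈ B) by apply C. assert (HW' : W' ∈ B) by apply C'.
    destruct (nat_trichotomy (ap f W) (ap f W')) as [K|[K|K]]; auto.
    + destruct (L' W); auto.
    + destruct (L W'); auto.
Qed.

(** [p] lies in all sets of the nested sequence that starts at [V] and takes the admissible
    base set of least index at each step. *)
Definition run i V p : Prop := exists s, is_fun s omega B /\ ap s empty = V /\
  (forall n, is_nat n -> ap s (succ n) = next i n (ap s n)) /\
  p ∈ X /\ forall n, is_nat n -> p ∈ ap s n.
#[local] Instance rel_run : Rel3 run. Proof. dfn. Qed.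

Definition pick i V : M := the (run i V).
#[local] Instance fun_pick : Fun2 pick. Proof. dfn. Qed.

(** A choice function without the axiom of choice: every step of the nested sequence is the
    least admissible one, the intersection is nonempty by completeness and has at most one
    point because the sets become small. *)
Lemma pick_spec i V : is_nat i -> meets i V -> pick i V ∈ V /\ pick i V ∈ core i.
Proof.
  intros Hi HV.
  assert (inv : forall s, ap s empty = V -> (forall n, is_nat n ->
    ap s (succ n) = next i n (ap s n)) ->
    forall n, is_nat n -> meets i (ap s n)).
  { intros s H0 HS. apply nat_induction; [dfn|rewrite H0; auto|].
    intros n Hn IH; rewrite HS by auto. apply next_candidate; auto. }
  assert (step : forall s, ap s empty = V -> (forall n, is_nat n ->
    ap s (succ n) = next i n (ap s n)) ->
    forall n, is_nat n -> candidate i n (ap s n) (ap s (succ n))).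
  { intros s H0 HS n Hn. rewrite HS by auto. apply next_candidate; auto. }
  assert (P : run i V (pick i V)).
  { apply (the_in (run i V)).
    - destruct (recursion (sep B (meets i)) V (next i)) as (s & Hs & H0 & HS); [dfn| | |].
      + rewrite in_sep by dfn; split; auto; apply HV.
      + intros n W Hn HW; rewrite in_sep in * by dfn.
        destruct (next_candidate i n W) as (K & _); auto; [apply HW|]. split; auto; apply K.
      + assert (Hs' : is_fun s omega B).
        { eapply fun_weaken; eauto. intros n Hn; pose proof (fun_in _ _ _ _ Hs Hn) as K.
          rewrite in_sep in K by dfn; apply K. }
        destruct (nested_intersection s) as (p & Hp & K); auto.
        * intros n Hn. destruct (inv s H0 HS n Hn) as (_ & x & Hx & _); exists x; auto.
        * intros n Hn. apply (step s H0 HS n Hn).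
        * intros n Hn. apply (step s H0 HS n Hn).
        * exists p, s; auto 6.
    - intros p q (s & Hs & H0 & HS & Xp & Hp) (s' & Hs' & H0' & HS' & Xq & Hq).
      assert (Es : forall n, is_nat n -> ap s n = ap s' n).
      { apply nat_induction; [dfn|congruence|]. intros n Hn IH; rewrite HS, HS', IH; auto. }
      set (A := sep X (fun x => forall n, is_nat n -> x ∈ ap s n)).
      assert (HA : forall x, x ∈ A <-> x ∈ X /\ forall n, is_nat n -> x ∈ ap s n)
        by (intros; unfold A; rewrite in_sep by dfn; tauto).
      apply (small_null_unique R X d Hd E A); auto.
      + intros x Hx; apply HA in Hx; tauto.
      + intros n Hn x y Hx Hy.
        assert (HT' : ap s (succ n) ∈ T) by (apply HB; eapply fun_in; eauto;
          apply in_omega, nat_succ; auto).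
        apply (step s H0 HS n Hn); apply (sub_closure X T hT); auto; apply HA; auto using nat_succ.
      + apply HA; auto.
      + apply HA; split; auto. intros n Hn; rewrite Es; auto. }
  destruct P as (s & Hs & H0 & HS & Xp & Hp). split.
  - rewrite <- H0 at 2. apply Hp, nat_empty.
  - apply in_core; split; auto. intros n Hn.
    apply (step s H0 HS n Hn). apply (sub_closure X T hT); auto using nat_succ.
    apply HB; eapply fun_in; eauto; apply in_omega, nat_succ; auto.
Qed.

(** Let [D] collect the picked points of all base sets and all pieces. A point of [S] outside
    a finite [D] would have a base neighborhood [V] disjoint from [D]; but [V] meets the piece
    of that point, so a point of [D] was picked in [V]. Hence [D] is infinite, and it is
    enumerated by piece and base index. *)
Lemma dedekind_of_union_of_Gdelta S A : S ⊆ A -> A ⊆ X -> infinite S ->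
  (forall x, x ∈ S <-> exists i, is_nat i /\ x ∈ core i) -> dedekind_infinite A.
Proof.
  intros SA AX Sinf HS.
  set (D := sep S (fun x => exists i V, is_nat i /\ meets i V /\ x = pick i V)).
  assert (HD : forall x, x ∈ D <-> exists i V, is_nat i /\ meets i V /\ x = pick i V).
  { intros x; unfold D; rewrite in_sep by dfn. split; [tauto|]. intros H; split; auto.
    destruct H as (i & V & Hi & HV & ->). apply HS; exists i; split; auto. apply pick_spec; auto. }
  assert (DS : D ⊆ S) by (intros x Hx; unfold D in Hx; rewrite in_sep in Hx by dfn; tauto).
  assert (Dinf : infinite D).
  { rewrite infinite_iff in *. intros Dfin; apply Sinf, (finite_subset D); auto.
    intros x Hx. apply NNPP; intros N.
    destruct (avoid_finite X T hT (punctured_open R X d T Hd HT) x D) as (W & HW & Wx & K); auto.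
    destruct (proj2 HB W x HW Wx) as (V & HV & Vx & VW).
    apply HS in Hx as (i & Hi & Hx).
    assert (MV : meets i V) by (split; eauto).
    destruct (pick_spec i V Hi MV) as [K1 K2].
    apply N. rewrite <- (K (pick i V)); auto; apply HD; eauto. }
  apply (dedekind_of_enumeration A D
    (fun i k x => exists V, meets i V /\ ap f V = k /\ x = pick i V)); auto.
  - dfn.
  - intros x Hx; auto.
  - intros i k x y Hi Hk _ _ (V & HV & <- & ->) (W & HW & Ef & ->).
    rewrite (If W V); auto; [apply HW|apply HV].
  - intros x Hx; apply HD in Hx as (i & V & Hi & HV & ->). exists i, (ap f V); split; auto; split.
    + apply Hf, HV.
    + eauto.
Qed.

End Pick.

(** An open set containing [C] for every closed [C]: the complement of the closure of the
    n-th base set if that closure is disjoint from [C], and the whole space otherwise. By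
    regularity these sets intersect in [C] ([separator_core]), uniformly in [C]. *)
Definition separator C n : M :=
  sep X (fun x => forall V, V ∈ B -> ap f V = n -> x ∈ closure V -> exists y, y ∈ C /\
    y ∈ closure V).

#[local] Instance fun_separator : Fun2 separator. Proof. dfn. Qed.

Lemma in_separator C n x : x ∈ separator C n <-> x ∈ X /\
  forall V, V ∈ B -> ap f V = n -> x ∈ closure V -> exists y, y ∈ C /\ y ∈ closure V.
Proof. unfold separator; rewrite in_sep by dfn; tauto. Qed.

Lemma separator_open C n : separator C n ∈ T.
Proof.
  apply (open_local X T hT). { intros x Hx; apply in_separator in Hx; tauto. }
  intros x Hx; apply in_separator in Hx as [Hx K].
  destruct (classic (exists V, V ∈ B /\ ap f V = n /\ forall y, y ∈ C -> ~ y ∈ closure V))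
    as [(V & HV & EV & D)|N].
  - assert (Nx : ~ x ∈ closure V) by (intros L; destruct (K V) as (y & Hy & L'); auto; apply (D y);
      auto).
    destruct (closed_sep X T (closure V) x) as (W & HW & Wx & L); auto.
      { apply closure_closed; auto. }
    exists W; split; auto; split; auto. intros y Hy; apply in_separator; split.
    + apply (open_sub X T hT W); auto.
    + intros V' HV' EV'. rewrite (If V' V); auto; [|congruence]. intros H; destruct (L y); auto.
  - exists X; split; [apply hT|split; auto]. intros y Hy; apply in_separator; split; auto.
    intros V HV EV _. apply NNPP; intros H; apply N; exists V; split; auto; split; auto.
    intros z Hz1 Hz2; apply H; eauto.
Qed.

Lemma separator_core C x : closed X T C ->
  (x ∈ C <-> x ∈ X /\ forall n, is_nat n -> x ∈ separator C n).
Proof.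
  intros HCl; split.
  - intros Hx; assert (x ∈ X) by (apply HCl; auto). split; auto.
    intros n Hn; apply in_separator; split; auto. intros V _ _ Hc; eauto.
  - intros [Hx H]. apply NNPP; intros N.
    destruct (closed_sep X T C x) as (W & HW & Wx & D); auto.
    destruct (small_nbhd R X d T Hd HT B W x (ap E empty)) as (V & HV & Vx & CW & _); auto.
      { apply E_pos, nat_empty. }
    specialize (H (ap f V) (Hf V HV)). apply in_separator in H as [_ H].
    destruct (H V) as (y & Cy & Vy); auto. { apply (sub_closure X T hT); auto. apply HB; auto. }
    apply (D y); auto.
Qed.

Lemma dedekind_of_Gdelta S A : S ⊆ A -> A ⊆ X -> infinite S -> is_Gdelta X T S ->
  dedekind_infinite A.
Proof.
  intros SA AX Sinf (G & HG & HS). apply is_seq_iff in HG.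
  assert (HU : forall n, is_nat n -> ap G n ∈ T) by (intros; eapply fun_in; eauto; apply in_omega;
    auto).
  assert (FU : Fun2 (fun i n : M => ap G n)) by dfn.
  apply (dedekind_of_union_of_Gdelta _ FU) with S; auto.
  intros x; rewrite HS; split.
  - intros [Hx H]; exists empty; split; [apply nat_empty|]. apply in_core; auto; split; auto.
    intros n Hn; apply (H n); auto. eapply app_ap; eauto; apply in_omega; auto.
  - intros (i & _ & H). apply in_core in H as [Hx H]; auto. split; auto. intros n V Hn HV.
    apply (fun_app G omega T) in HV; auto; [subst; auto|apply in_omega; auto].
Qed.

Lemma closed_Gdelta C : closed X T C -> is_Gdelta X T C.
Proof.
  intros H. apply (Gdelta_intro X T) with (separator C).
  - dfn.
  - intros; apply separator_open.
  - intros x; apply separator_core; auto.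
Qed.

(** The separators turn the sequence of closed pieces into a uniform family of G-delta sets. *)
Lemma dedekind_of_Fsigma S A : S ⊆ A -> A ⊆ X -> infinite S -> is_Fsigma X T S ->
  dedekind_infinite A.
Proof.
  intros SA AX Sinf (K & F & HK & HF & HS). apply is_seq_iff in HF.
  assert (FK : forall n, is_nat n -> closed X T (ap F n)) by (intros; apply HK; eapply fun_in;
    eauto; apply in_omega; auto).
  assert (FU : Fun2 (fun i n : M => separator (ap F i) n)) by dfn.
  apply (dedekind_of_union_of_Gdelta _ FU) with S; auto.
  { intros; apply separator_open. }
  intros x; rewrite HS; split.
  - intros (n & C & Hn & Ha & HC'). exists n; split; auto.
    apply (fun_app F omega K) in Ha; [subst C|auto|apply in_omega; auto].
    apply in_core; auto. apply (separator_core (ap F n)); auto.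
  - intros (n & Hn & H). exists n, (ap F n); split; auto; split.
    + eapply app_ap; eauto; apply in_omega; auto.
    + apply in_core in H; auto. apply (separator_core (ap F n)); auto.
Qed.

(** A sequence in [A] that converges outside [A] has infinite range. *)
Lemma dedekind_of_not_seq_closed A : A ⊆ X -> ~ sequentially_closed X T A -> dedekind_infinite A.
Proof.
  intros AX N.
  assert (exists s x, is_seq s A /\ x ∈ X /\ converges T s x /\ ~ x ∈ A)
    as (s & x & Hs & Hx & Hc & Nx).
  { apply NNPP; intros K; apply N; split; auto. intros s x Hs Hx Hc. apply NNPP; intros L; apply K.
    exists s, x; auto. }
  apply is_seq_iff in Hs.
  assert (sA : forall n, is_nat n -> ap s n ∈ A) by (intros; eapply fun_in; eauto; apply in_omega;
    auto).
  apply (dedekind_of_enumeration A (range s A) (fun n _ y => y = ap s n)).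
  - dfn.
  - intros y Hy; apply in_range in Hy as (n & Hn & ->); auto.
  - apply (convergent_range_infinite X T hT (punctured_open R X d T Hd HT) s A x); auto.
    intros n Hn En; apply Nx; rewrite <- En; auto.
  - intros; congruence.
  - intros y Hy; apply in_range in Hy as (n & Hn & ->); auto. exists n, empty; auto using nat_empty.
Qed.

(** Let [c] be an injective sequence in [A]. Either its range has an accumulation point, which
    is then the limit of a sequence that omits it, or its range is closed. *)
Lemma dedekind_subset A : A ⊆ X -> dedekind_infinite A -> exists S, S ⊆ A /\ infinite S /\
  (closed X T S \/ exists x s, x ∈ X /\ ~ x ∈ S /\ closed X T (cup S (sing x)) /\
     is_seq s A /\ converges T s x).
Proof.
  intros AX HA. destruct (dedekind_sequence A HA) as (c & Hc & I).
  assert (RA : forall s, is_fun s omega A -> range s A ⊆ A).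
  { intros s Hs y Hy; apply in_range in Hy as (n & Hn & ->); auto.
    eapply fun_in; eauto; apply in_omega; auto. }
  destruct (classic (exists x, x ∈ X /\ forall U, U ∈ T -> x ∈ U ->
     exists m, is_nat m /\ ap c m ∈ U /\ ap c m <> x)) as [(x & Hx & H)|N].
  - destruct (sequence_to_accumulation_point X T hT B f HB Hf If c A x) as (s & Hs & Hsx & Ns);
      auto.
    exists (range s A); split; auto; split.
    + apply (convergent_range_infinite X T hT (punctured_open R X d T Hd HT) s A x); auto.
    + right; exists x, s; split; auto; split; [|split; [|split; auto; apply is_seq_iff; auto]].
      * intros K; apply in_range in K as (n & Hn & E'); auto. apply (Ns n); auto.
      * apply (convergent_range_closed X T hT (punctured_open R X d T Hd HT)); auto.
        intros y Hy Nyx.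
        destruct (small_nbhd R X d T Hd HT B (sep X (fun z => z <> y)) x (ap E empty))
          as (V & HV & Vx & CV & _); auto.
        { apply (punctured_open R X d T); auto. }
        { apply in_punctured; auto. }
        { apply E_pos, nat_empty. }
        exists V; split; [apply HB; auto|split; auto]. intros K; apply CV, in_punctured in K; tauto.
  - exists (range c A); split; auto; split; [apply range_infinite; auto|]. left.
    apply closed_local; auto. { intros y Hy; apply AX; apply (RA c); auto. }
    intros x Hx Nx. apply NNPP; intros K; apply N; exists x; split; auto.
    intros U HU Ux. apply NNPP; intros L; apply K; exists U; split; auto; split; auto.
    intros y Uy Hy. apply in_range in Hy as (m & Hm & ->); auto. apply L; exists m; split; auto;
      split; auto.
    intros Ex; apply Nx. apply in_range; eauto.
Qed.

End Complete.

(** * The four equivalent conditions *)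

Theorem corollary4p2 (M : ZF) (R : reals M) (X T : M)
  (hT : is_topology X T)
  (hsc : second_countable T)
  (hcm : cantor_completely_metrizable R X T) :
  let S1 := forall A : M, A ⊆ X -> infinite A -> dedekind_infinite A in
  let S2 := forall A : M, A ⊆ X -> infinite A ->
              exists B : M, B ⊆ A /\ infinite B /\ is_Gdelta X T B in
  let S3 := forall A : M, A ⊆ X -> infinite A ->
              exists B : M, B ⊆ A /\ infinite B /\ is_Fsigma X T B in
  let S4 := forall A : M, sequentially_closed X T A -> infinite A ->
              exists B : M, B ⊆ A /\ infinite B /\ closed X T B in
  (S1 <-> S2) /\ (S1 <-> S3) /\ (S1 <-> S4).
Proof.
  destruct hsc as (B & HB & b & Hb & Eb). apply equip_elim in Eb as (f & Ff & If & _).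
  assert (Hf : forall V, V ∈ B -> is_nat (ap f V)) by (intros; apply Hb; eapply fun_in; eauto).
  destruct hcm as (d & Hd & HC & HT).
  destruct (null_sequence R) as (E & E_pos & E_mono & E_null).
  intros S1 S2 S3 S4; split; [|split]; split; intros H A.
  - intros HA Ainf.
    destruct (dedekind_subset R X T d hT Hd HT B f HB Hf If E E_pos A) as (S & SA & Sinf & K); auto.
    exists S; split; auto; split; auto. destruct K as [K|(x & s & Hx & Nx & K & _)].
    + eapply closed_Gdelta; eauto.
    + assert (O : forall n, inter (separator X T B f (cup S (sing x)) n)
        (sep X (fun z => z <> x)) ∈ T).
      { intros n; apply (inter_open X T hT); [eapply separator_open|eapply punctured_open]; eauto. }
      (* the closed set without its limit point *)
      apply (Gdelta_intro X T S (fun n => inter (separator X T B f (cup S (sing x)) n)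
        (sep X (fun z => z <> x)))); auto.
      { dfn. }
      intros y. pose proof (separator_core R X T d hT Hd HT B f HB Hf E E_pos _ y K) as L.
      rewrite in_cup, in_sing in L. split.
      * intros Hy. destruct (proj1 L (or_introl Hy)) as [Xy L']. split; auto.
        intros n Hn. rewrite in_inter, in_punctured; split; auto; split; auto. congruence.
      * intros [Xy L']. destruct (proj2 L) as [|Ey]; auto.
        -- split; auto. intros n Hn; specialize (L' n Hn); apply in_inter in L'; tauto.
        -- specialize (L' empty nat_empty). rewrite in_inter, in_punctured in L'; tauto.
  - intros HA Ainf. destruct (H A HA Ainf) as (S & SA & Sinf & G).
    eapply dedekind_of_Gdelta with (S := S); eauto.
  - intros HA Ainf. destruct (dedekind_sequence A (H A HA Ainf)) as (c & Hc & I).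
    exists (range c A); split; [|split].
    + intros y Hy; apply in_range in Hy as (n & Hn & ->); auto. eapply fun_in; eauto;
        apply in_omega; auto.
    + apply range_infinite; auto.
    + apply range_Fsigma; auto. eapply punctured_open; eauto.
  - intros HA Ainf. destruct (H A HA Ainf) as (S & SA & Sinf & G).
    eapply dedekind_of_Fsigma with (S := S); eauto.
  - intros HA Ainf. assert (AX : A ⊆ X) by apply HA.
    destruct (dedekind_subset R X T d hT Hd HT B f HB Hf If E E_pos A) as (S & SA & Sinf & K); auto.
    destruct K as [K|(x & s & Hx & Nx & K & Hs & Hc)]; eauto.
    exists (cup S (sing x)); split; [|split]; auto.
    + intros y Hy; rewrite in_cup, in_sing in Hy; destruct Hy as [Hy| ->]; auto.
      apply (proj2 HA s); auto.
    + apply (infinite_superset S); auto. intros y Hy; apply in_cup; auto.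
  - intros HA Ainf. destruct (classic (sequentially_closed X T A)) as [Q|Q].
    + destruct (H A Q Ainf) as (S & SA & Sinf & G).
      eapply dedekind_of_Gdelta with (S := S); eauto. eapply closed_Gdelta; eauto.
    + eapply dedekind_of_not_seq_closed; eauto.
Qed.
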